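(* Let $\Gamma$ be a discrete group and $\Sigma\subseteq\Gamma$ a finite non-empty subset. The map $$\varphi:\mathrm{C}^*(\Gamma)^{(\Sigma)}\to \mathrm{SOS}(\Sigma)^{\mathrm d},\qquad T\mapsto\phi_T,$$ where $\phi_T(\delta_{st^{-1}})=T_{s,t}$ for $s,t\in\Sigma$, is a complete order isomorphism, and hence its dual map $$\varphi^{\mathrm d}:\mathrm{SOS}(\Sigma)\to(\mathrm{C}^*(\Gamma)^{(\Sigma)})^{\mathrm d}$$ (that is, $\varphi^{\mathrm d}(x)(T)=\phi_T(x)$) is a complete order isomorphism. Furthermore, $\varphi(\mathbf 1)$ is the functional on $\mathrm{SOS}(\Sigma)$ with $\delta_{st^{-1}}\mapsto 1$ if $s=t$ and $\delta_{st^{-1}}\mapsto 0$ otherwise, and $\varphi^{\mathrm d}(\delta_e)$ is the functional $T\mapsto \frac{1}{|\Sigma|}\mathrm{Tr}(T)$.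
   Context: $\mathrm{M}_n=\mathrm{M}_n(\mathbb{C})$. $\mathrm{C}^*(\Gamma)$ is the universal group C$^*$-algebra with canonical unitaries $\delta_s$, $s\in\Gamma$. A linear map $\phi$ between matrix ordered vector spaces is completely positive (cp) if all amplifications $\phi^{(n)}$ map $\mathrm{M}_n(X)^+$ into $\mathrm{M}_n(Y)^+$; a complete order isomorphism is a bijective cp map with cp inverse (not necessarily unital). For an operator system $X$, $X^{\mathrm d}$ is the linear span of the positive functionals on $X$, with positive cones $\mathrm{M}_n(X^{\mathrm d})^+:=\mathcal{CP}(X,\mathrm{M}_n)$ (an element $(f_{ij})$ of $\mathrm{M}_n(X^{\mathrm d})$ being viewed as the map $x\mapsto(f_{ij}(x))$). The Toeplitz system $\mathrm{C}^*(\Gamma)^{(\Sigma)}$ is the operator subsystem of $\mathrm{M}_\Sigma=\mathcal{B}(\ell^2(\Sigma))$ consisting of all matrices $T=(T_{s,t})_{s,t\in\Sigma}$ with $T_{s_1,t_1}=T_{s_2,t_2}$ whenever $s_1t_1^{-1}=s_2t_2^{-1}$; $\mathbf 1$ is the identity matrix. The sums-of-squares system $\mathrm{SOS}(\Sigma)$ is the $*$-vector space $\mathrm{S}[\Sigma\Sigma^{-1}]=\mathrm{span}\{\delta_{st^{-1}}\mid s,t\in\Sigma\}\subseteq \mathrm{C}^*(\Gamma)$ with Archimedean matrix order unit $\delta_e$ and positive cones $\mathrm{M}_n(\mathrm{SOS}(\Sigma))^+=\mathcal{Q}_n(\Sigma)=\{\sum_{i=1}^r y_iy_i^*\mid r\in\mathbb{N},\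 y_i=\sum_{s\in\Sigma}A^i_s\otimes\delta_s,\ A_s^i\in \mathrm{M}_n\}$. *)

(* Defs.v *)
From HB Require Import structures.
From mathcomp Require Import all_boot all_order all_algebra finmap complex.
From mathcomp Require Import all_classical all_reals all_analysis.

Set Implicit Arguments.
Unset Strict Implicit.
Unset Printing Implicit Defensive.

Import Order.TTheory GRing.Theory Num.Theory.
Import numFieldNormedType.Exports.

Local Open Scope classical_set_scope.
Local Open Scope ring_scope.
Local Open Scope complex_scope.

(* The library's normed modules cannot be joined with its algebras, so norms
   (with values in the nonnegative elements of R[i]) and completeness are
   spelled out. *)
Definition norm_complete (R : realType) (V : zmodType) (nrm : V -> R[i]) : Prop :=
  forall u : nat -> V,
    (forall e, 0 < e -> exists N, forall m n,
       (N <= m)%N -> (N <= n)%N -> nrm (u m - u n) < e) ->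
    exists l, forall e, 0 < e -> exists N, forall n,
       (N <= n)%N -> nrm (u n - l) < e.

HB.mixin Record isCStarAlgebra (R : realType) A of GRing.Algebra R[i] A := {
  cnorm : A -> R[i];
  cnormD : forall x y : A, cnorm (x + y) <= cnorm x + cnorm y;
  cnormZ : forall (a : R[i]) (x : A), cnorm (a *: x) = `|a| * cnorm x;
  cnorm0_eq0 : forall x : A, cnorm x = 0 -> x = 0;
  cnormM : forall x y : A, cnorm (x * y) <= cnorm x * cnorm y;
  cnorm_complete : norm_complete cnorm;
  adj : A -> A;
  adjK : involutive adj;
  adjZD : forall (a : R[i]) (x y : A),
    adj (a *: x + y) = Num.conj a *: adj x + adj y;
  adjM : forall x y : A, adj (x * y) = adj y * adj x;
  cnorm_adjM : forall x : A, cnorm (adj x * x) = cnorm x ^+ 2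
}.

#[short(type="cstarAlgebraType")]
HB.structure Definition CStarAlgebra (R : realType) :=
  { A of isCStarAlgebra R A & GRing.Algebra R[i] A }.

Section GroupCStar.
Variables (R : realType) (G : groupType).

Definition hnorm (H : lmodType R[i]) (dot : {dot H for (@Num.conj R[i])})
  (v : H) : R[i] := sqrtC (dot v v).

(* The first field makes [H] a Hilbert space. *)
Record unitary_rep (H : lmodType R[i]) (dot : {dot H for (@Num.conj R[i])})
    (pi : G -> H -> H) : Prop := {
  rep_complete : norm_complete (hnorm dot);
  rep_linear : forall s, linear (pi s);
  rep1 : forall v, pi 1%g v = v;
  repM : forall s t v, pi (s * t)%g v = pi s (pi t v);
  rep_isometry : forall s u v, dot (pi s u) (pi s v) = dot u v
}.

(* All ||pi(x)v||, for x = \sum_(s <- F) a s *: s in the group algebra, pi a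
   unitary representation and v in the unit ball; their least upper bound is the
   universal norm of x. *)
Definition rep_norms (F : seq G) (a : G -> R[i]) : set R[i] :=
  [set r | exists (H : lmodType R[i]) (dot : {dot H for (@Num.conj R[i])})
             (pi : G -> H -> H) (v : H),
     [/\ unitary_rep dot pi, hnorm dot v <= 1
       & r = hnorm dot (\sum_(s <- F) a s *: pi s v)]].

(* [A] with [delta] is the completion of the group algebra for the universal
   norm, i.e. the universal group C*-algebra with its canonical unitaries. *)
Record is_group_cstar (A : cstarAlgebraType R) (delta : G -> A) : Prop := {
  delta1 : delta 1%g = 1;
  deltaM : forall s t, delta (s * t)%g = delta s * delta t;
  deltaV : forall s, delta s^-1%g = adj (delta s);
  delta_dense : forall (x : A) e, 0 < e ->
    exists (F : seq G) (a : G -> R[i]),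
      cnorm (x - \sum_(s <- F) a s *: delta s) < e;
  delta_norm : forall (F : seq G) (a : G -> R[i]),
    supremums (rep_norms F a) (cnorm (\sum_(s <- F) a s *: delta s))
}.

End GroupCStar.

(* Only the cones are recorded: complete positivity and duals do not involve
   the involution or the order unit. *)
HB.mixin Record hasMatrixCones (R : realType) V of GRing.Lmodule R[i] V := {
  mcone : forall n, set 'M[V]_n
}.

#[short(type="matrixOrderedType")]
HB.structure Definition MatrixOrdered (R : realType) :=
  { V of hasMatrixCones R V & GRing.Lmodule R[i] V }.

Definition completely_positive (R : realType) (X Y : matrixOrderedType R)
    (f : X -> Y) : Prop :=
  linear f /\ forall n (M : 'M[X]_n), mcone n M -> mcone n (map_mx f M).

Definition complete_order_iso (R : realType) (X Y : matrixOrderedType R)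
    (f : X -> Y) : Prop :=
  completely_positive f /\
  exists g : Y -> X, [/\ cancel f g, cancel g f & completely_positive g].

Section MatrixAlgebra.
Variable R : realType.

Definition posmx n (M : 'M[R[i]]_n) : Prop :=
  forall v : 'cV[R[i]]_n, 0 <= ((map_mx Num.conj v)^T *m M *m v) 0 0.

Definition matrix_mcone m n (M : 'M['M[R[i]]_m]_n) : Prop :=
  posmx (\mxblock_(i < n, j < n) M i j).

HB.instance Definition _ m :=
  hasMatrixCones.Build R 'M[R[i]]_m (@matrix_mcone m).

End MatrixAlgebra.

Section Dual.
Variables (R : realType) (X : matrixOrderedType R).

Definition positive_functional (f : X -> R[i]^o) : Prop :=
  linear f /\ forall x : X, mcone 1 (const_mx x) -> 0 <= f x.

Definition dual_pred : {pred (X -> R[i]^o)} := fun f =>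
  `[< exists r (c : 'I_r -> R[i]) (p : 'I_r -> X -> R[i]^o),
        (forall k, positive_functional (p k)) /\
        f = \sum_(k < r) c k *: p k >].

Lemma dual_pred_closed : submod_closed dual_pred.
Proof.
split=> [|a f g /asboolP[r [c [p [hp ->]]]] /asboolP[q [d [h [hh ->]]]]].
  apply/asboolP; exists 0%N, (fun=> 0), (fun=> 0).
  by split=> [[]//|]; rewrite big_ord0.
apply/asboolP; exists (r + q)%N.
exists (fun k => match fintype.split k with inl i => a * c i | inr j => d j end).
exists (fun k => match fintype.split k with inl i => p i | inr j => h j end).
split=> [k|]; first by case: fintype.split.
rewrite big_split_ord /= scaler_sumr; congr (_ + _); apply: eq_bigr => k _.
  by rewrite (unsplitK (inl k)) scalerA.
by rewrite (unsplitK (inr k)).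
Qed.

HB.instance Definition _ := GRing.isSubmodClosed.Build R[i] (X -> R[i]^o)
  dual_pred dual_pred_closed.

Record dual := Dual { dual_fun :> X -> R[i]^o; _ : dual_fun \in dual_pred }.

HB.instance Definition _ := [isSub for dual_fun].
HB.instance Definition _ := [Choice of dual by <:].
HB.instance Definition _ := [SubChoice_isSubLmodule of dual by <:].

Definition dual_mcone n (f : 'M[dual]_n) : Prop :=
  completely_positive (fun x : X => \matrix_(i, j) (f i j x : R[i])).

HB.instance Definition _ := hasMatrixCones.Build R dual dual_mcone.

End Dual.

Section Toeplitz.
Variables (R : realType) (G : groupType) (S : {fset G}).

(* The matrices in B(l^2(S)), with S enumerated by [enum_rank]. *)
Definition entry (T : 'M[R[i]]_#|{: S}|) (s t : S) : R[i] :=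
  T (enum_rank s) (enum_rank t).

Definition toeplitz_pred : {pred 'M[R[i]]_#|{: S}|} := fun T =>
  [forall s1 : S, forall t1 : S, forall s2 : S, forall t2 : S,
    (val s1 * (val t1)^-1 == val s2 * (val t2)^-1)%g ==>
    (entry T s1 t1 == entry T s2 t2)].

Lemma toeplitz_predP T : reflect
  (forall s1 t1 s2 t2 : S,
     (val s1 * (val t1)^-1 = val s2 * (val t2)^-1)%g ->
     entry T s1 t1 = entry T s2 t2)
  (T \in toeplitz_pred).
Proof.
apply: (iffP 'forall_'forall_'forall_'forall_implyP) => h s1 t1 s2 t2.
  by move=> /eqP/h/eqP.
by move=> /eqP/h->.
Qed.

Lemma toeplitz_closed : submod_closed toeplitz_pred.
Proof.
split=> [|a T U /toeplitz_predP hT /toeplitz_predP hU];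
  apply/toeplitz_predP => s1 t1 s2 t2 e; rewrite /entry !mxE //.
by congr (_ * _ + _); [apply: hT | apply: hU].
Qed.

HB.instance Definition _ := GRing.isSubmodClosed.Build R[i] 'M[R[i]]_#|{: S}|
  toeplitz_pred toeplitz_closed.

Record toeplitz := Toeplitz
  { toeplitz_val :> 'M[R[i]]_#|{: S}|; _ : toeplitz_val \in toeplitz_pred }.

HB.instance Definition _ := [isSub for toeplitz_val].
HB.instance Definition _ := [Choice of toeplitz by <:].
HB.instance Definition _ := [SubChoice_isSubLmodule of toeplitz by <:].

Definition toeplitz_mcone n (M : 'M[toeplitz]_n) : Prop :=
  mcone n (map_mx toeplitz_val M).

HB.instance Definition _ := hasMatrixCones.Build R toeplitz toeplitz_mcone.

Lemma toeplitz1_subproof : 1%:M \in toeplitz_pred.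
Proof.
apply/toeplitz_predP => s1 t1 s2 t2 e.
rewrite /entry !mxE !(inj_eq enum_rank_inj); congr (_%:R); congr nat_of_bool.
rewrite -!val_eqE -(inj_eq (mulIg (val t1)^-1%g)) mulgV e.
by rewrite -[RHS](inj_eq (mulIg (val t2)^-1%g)) mulgV.
Qed.

Definition toeplitz1 : toeplitz := Toeplitz toeplitz1_subproof.

End Toeplitz.

Section SumsOfSquares.
Variables (R : realType) (G : groupType).
Variables (A : cstarAlgebraType R) (delta : G -> A) (S : {fset G}).

Definition sos_pred : {pred A} := fun x =>
  `[< exists c : S -> S -> R[i],
        x = \sum_s \sum_t c s t *: delta (val s * (val t)^-1)%g >].

Lemma sos_closed : submod_closed sos_pred.
Proof.
split=> [|a x y /asboolP[c ->] /asboolP[d ->]]; apply/asboolP.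
  exists (fun _ _ => 0); symmetry; apply: big1 => s _; apply: big1 => t _.
  by rewrite scale0r.
exists (fun s t => a * c s t + d s t).
rewrite scaler_sumr -big_split /=; apply: eq_bigr => s _.
rewrite scaler_sumr -big_split /=; apply: eq_bigr => t _.
by rewrite scalerDl scalerA.
Qed.

HB.instance Definition _ := GRing.isSubmodClosed.Build R[i] A
  sos_pred sos_closed.

Record sos := Sos { sos_val :> A; _ : sos_val \in sos_pred }.

HB.instance Definition _ := [isSub for sos_val].
HB.instance Definition _ := [Choice of sos by <:].
HB.instance Definition _ := [SubChoice_isSubLmodule of sos by <:].

Definition tensmx n (B : 'M[R[i]]_n) (a : A) : 'M[A]_n :=
  map_mx (fun c => c *: a) B.

Definition adjmx n (Y : 'M[A]_n) : 'M[A]_n := map_mx (@adj R A) Y^T.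

Definition sos_mcone n (M : 'M[sos]_n) : Prop :=
  exists r (B : 'I_r -> S -> 'M[R[i]]_n),
    let y k := \sum_(s : S) tensmx (B k s) (delta (val s)) in
    map_mx sos_val M = \sum_(k < r) y k *m adjmx (y k).

HB.instance Definition _ := hasMatrixCones.Build R sos sos_mcone.

Lemma sos_delta_subproof (s t : S) :
  delta (val s * (val t)^-1)%g \in sos_pred.
Proof.
apply/asboolP; exists (fun s' t' => ((s' == s) && (t' == t))%:R).
rewrite (bigD1 s) //= (bigD1 t) //= !eqxx scale1r big1 ?addr0 => [|t' /negPf->].
  rewrite big1 ?addr0 // => s' /negPf->.
  by apply: big1 => t' _; rewrite scale0r.
by rewrite andbF scale0r.
Qed.

Definition sos_delta (s t : S) : sos := Sos (sos_delta_subproof s t).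

Lemma sos_unit_subproof : S != fset0 -> delta 1%g \in sos_pred.
Proof.
case/fset0Pn => s sS; rewrite -(mulgV s).
exact: (sos_delta_subproof [` sS]%fset [` sS]%fset).
Qed.

Definition sos_unit (S0 : S != fset0) : sos := Sos (sos_unit_subproof S0).

End SumsOfSquares.

(* Main.v *)
Require Import Defs.
From HB Require Import structures.
From mathcomp Require Import all_boot all_order all_algebra finmap complex.
From mathcomp Require Import all_classical all_reals all_analysis.
From mathcomp Require Import ring lra.

(** Let D = S S^-1. A Toeplitz matrix T is determined by a function on D, and an
    element of SOS(S) by its coefficients along the delta_d, d in D, which are
    linearly independent: the universal norm dominates the norm in the left
    regular representation on l2(G), where the delta_d move the point mass at 1
    to distinct point masses ([delta_free]). So <T, delta_{s t^-1}> = T_{s,t}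
    defines a perfect pairing between two finite dimensional spaces
    ([pairingP], [toeplitz_functional]), and phi_T = <T, .>.

    Each map is completely positive because of [pairing_psd]: for
    y = sum_s B_s (x) delta_s one has y y^* = sum_{s,t} B_s B_t^* (x)
    delta_{s t^-1}, and pairing this with a positive block Toeplitz matrix T
    gives a compression of T.

    The inverse of phi is completely positive because the form of the block
    matrix (f (delta_{s t^-1})) at a vector is a value of f at a square y y^*
    ([toeplitz_to_dual_iso]). For the inverse of phi^d one has to produce a sum
    of squares. A completely positive matrix (f_kl) of functionals on the
    Toeplitz system gives one positive functional on block Toeplitz matrices,
    which extends to a positive functional on all block matrices by the theorem
    of M. Riesz ([riesz_extension], [toeplitz_cp_extension]). The coefficient
    matrix of the extension is positive, hence of the form V V^*
    ([psd_factor]), and the columns of V are the coefficients of the squares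
    ([sos_to_dual_iso]).

    Both maps take their values in the spans of the positive functionals: a
    Toeplitz matrix is a combination of positive ones since a large multiple of
    the identity dominates any Hermitian matrix, and the functionals
    T |-> T_{s,t} are combinations of vector functionals by polarization.
    Finally 1/|S| Tr (T) is the common diagonal entry of T, and the unit of
    SOS(S) is delta_{s s^-1}. *)

Set Implicit Arguments.
Unset Strict Implicit.
Unset Printing Implicit Defensive.

Import Order.TTheory GRing.Theory Num.Theory.
Import numFieldNormedType.Exports.

Local Open Scope ring_scope.
Local Open Scope complex_scope.

(** * Unordered sums of complex numbers *)

Section Sums.
Variables (R : realType) (I : choiceType).
Local Notation C := R[i].
Implicit Types (f g : I -> C) (A B : {fset I}).

(** Unordered summation: convergence along the directed set of finite
    subsets. It needs no enumeration of the index set, so that it applies to an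
    uncountable group, and it is visibly invariant under bijections. *)
Definition has_sum f (l : C) := forall e : C, 0 < e ->
  exists A, forall B, (A `<=` B)%fset -> `|l - \sum_(i <- B) f i| < e.

(** The form in which limits are identified below: two limits, or a number and
    its norm, are shown equal by bounding their distance by every e > 0. *)
Lemma le_small0 (x : C) : (forall e : C, 0 < e -> `|x| < e) -> x = 0.
Proof.
move=> h; apply/eqP; rewrite -normr_le0; apply: contraT => /negP h0.
have := h `|x|; rewrite ltxx => -> //.
by rewrite normr_gt0; apply/eqP => x0; apply: h0; rewrite x0 normr0.
Qed.

Lemma has_sum_close f l e : has_sum f l -> 0 < e ->
  forall A, exists2 B, (A `<=` B)%fset & `|l - \sum_(i <- B) f i| < e.
Proof.
move=> h e0 A; have [B hB] := h e e0.
by exists (A `|` B)%fset; [exact: fsubsetUl|apply: hB; exact: fsubsetUr].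
Qed.

Lemma has_sum_unique f l l' : has_sum f l -> has_sum f l' -> l = l'.
Proof.
move=> h h'; apply/eqP; rewrite -subr_eq0; apply/eqP/le_small0 => e e0.
have e2 : 0 < e / 2 by rewrite divr_gt0.
have [A hA] := h _ e2; have [B AB hB] := has_sum_close h' e2 A.
rewrite -[l - l'](subrKA (\sum_(i <- B) f i)) (splitr e).
apply: le_lt_trans (ler_normD _ _) _; apply: ltrD; first exact: hA.
by rewrite distrC.
Qed.

Lemma has_sumD f g l m : has_sum f l -> has_sum g m ->
  has_sum (fun i => f i + g i) (l + m).
Proof.
move=> hf hg e e0; have e2 : 0 < e / 2 by rewrite divr_gt0.
have [A hA] := hf _ e2; have [B hB] := hg _ e2.
exists (A `|` B)%fset => D; rewrite fsubUset => /andP[AD BD].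
rewrite big_split /= opprD addrACA (splitr e).
by apply: le_lt_trans (ler_normD _ _) _; apply: ltrD; [exact: hA|exact: hB].
Qed.

Lemma has_sumZ f l a : has_sum f l -> has_sum (fun i => a * f i) (a * l).
Proof.
move=> hf e e0; have a0 : 0 < `|a| + 1 by rewrite ltr_wpDl.
have [A hA] := hf (e / (`|a| + 1)) (divr_gt0 e0 a0).
exists A => B AB; rewrite -mulr_sumr -mulrBr normrM.
have := hA B AB; rewrite ltr_pdivlMr // mulrC; apply: le_lt_trans.
by rewrite ler_wpM2r // lerDl.
Qed.

Lemma has_sumJ f l : has_sum f l ->
  has_sum (fun i => Num.conj (f i)) (Num.conj l).
Proof.
move=> hf e e0; have [A hA] := hf e e0; exists A => B AB.
by rewrite -rmorph_sum -rmorphB norm_conjC hA.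
Qed.

Lemma has_sum_reindex f l (p q : I -> I) : cancel p q -> cancel q p ->
  has_sum f l -> has_sum (f \o p) l.
Proof.
move=> pK qK hf e e0; have [A hA] := hf e e0.
exists [fset q i | i in A]%fset => B AB.
have -> : \sum_(i <- B) (f \o p) i = \sum_(i <- [fset p i | i in B]%fset) f i.
  by rewrite big_imfset //= => x y _ _; exact: (can_inj pK).
apply: hA; apply/fsubsetP => i iA; apply/imfsetP; exists (q i) => //=.
by apply: (fsubsetP AB); apply/imfsetP; exists i.
Qed.

(** The nonnegative complex numbers are closed. The argument stays inside the
    partial order: x = |x| for nonnegative x, and z |-> |z| is 1-Lipschitz, so
    that l is arbitrarily close to |l|. *)
Lemma close_ge0 (l : C) :
  (forall e : C, 0 < e -> exists2 x : C, 0 <= x & `|l - x| < e) -> 0 <= l.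
Proof.
move=> h; suff -> : l = `|l| by [].
apply/eqP; rewrite -subr_eq0; apply/eqP/le_small0 => e e0.
have [x x0 hx] := h (e / 2) (divr_gt0 e0 (ltr0Sn _ 1)).
rewrite -(subrKA x) (splitr e); apply: le_lt_trans (ler_normD _ _) _.
apply: ltrD => //; rewrite -{1}(ger0_norm x0).
by rewrite distrC; apply: le_lt_trans (ler_dist_dist _ _) _.
Qed.

Lemma has_sum1 i0 (x : C) : has_sum (fun i => x *+ (i == i0)) x.
Proof.
move=> e e0; exists [fset i0]%fset => B; rewrite fsub1set => hi.
rewrite (big_fsetD1 i0) //= eqxx mulr1n big_seq big1 ?addr0 ?subrr ?normr0 //.
by move=> i; rewrite !inE => /andP[/negPf-> _].
Qed.

Lemma has_sum_le f l (M : C) : has_sum f l ->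
  (forall A, \sum_(i <- A) f i <= M) -> l <= M.
Proof.
move=> hf hM; rewrite -subr_ge0; apply: close_ge0 => e e0.
have [A _ hA] := has_sum_close hf e0 fset0.
exists (M - \sum_(i <- A) f i); first by rewrite subr_ge0.
set x := \sum_(i <- A) f i; have -> : M - l - (M - x) = x - l by ring.
by rewrite distrC.
Qed.

Lemma sum_fsubset f A B : (A `<=` B)%fset -> (forall i, 0 <= f i) ->
  \sum_(i <- A) f i <= \sum_(i <- B) f i.
Proof.
move=> AB f0; rewrite [leRHS](big_fsetID _ [in A]) /=.
have -> : [fset x | x in B & x \in A]%fset = A.
  apply/fsetP => i; rewrite !inE /= andbC.
  by case: (boolP (i \in A)) => //= /(fsubsetP AB).
by rewrite lerDl sumr_ge0.
Qed.

Lemma sum_le_has_sum f l A : has_sum f l -> (forall i, 0 <= f i) ->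
  \sum_(i <- A) f i <= l.
Proof.
move=> hf f0; rewrite -subr_ge0; apply: close_ge0 => e e0.
have [B AB hB] := has_sum_close hf e0 A.
exists (\sum_(i <- B) f i - \sum_(i <- A) f i).
  by rewrite subr_ge0 sum_fsubset.
set x := \sum_(i <- A) f i; set y := \sum_(i <- B) f i.
by have -> : l - x - (y - x) = l - y by ring.
Qed.

(** The only use of the completeness of the reals for sums: the limit is the
    supremum of the real parts of the partial sums. *)
Lemma bounded_has_sum f (M : C) : (forall i, 0 <= f i) ->
  (forall A, \sum_(i <- A) f i <= M) -> exists l, has_sum f l.
Proof.
move=> f0 hM.
pose E : set R :=
  [set x | exists A, x = complex.Re (\sum_(i <- A) f i)]%classic.
have Re_sum A : (complex.Re (\sum_(i <- A) f i))%:C = \sum_(i <- A) f i.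
  by apply: RRe_real; apply: ger0_real; rewrite sumr_ge0.
have M0 : (complex.Re M)%:C = M.
  by apply: RRe_real; apply: ger0_real; have := hM fset0; rewrite big_seq_fset0.
have hE : has_sup E.
  split; first by exists (complex.Re (\sum_(i <- fset0) f i)); exists fset0.
  exists (complex.Re M) => _ [A ->].
  by rewrite -lecR Re_sum M0.
exists (sup E)%:C => e e0.
have eR : (complex.Re e)%:C = e by apply: RRe_real; exact: gtr0_real.
have e0' : 0 < complex.Re e by rewrite -ltcR eR.
have [_ [A ->] hA] := sup_adherent e0' hE.
exists A => B AB; rewrite -Re_sum -rmorphB /=.
have hB : complex.Re (\sum_(i <- B) f i) <= sup E by apply: sup_upper_bound => //; exists B.
rewrite ger0_norm ?ler0c ?subr_ge0 // -eR ltcR ltrBlDr -ltrBlDl.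
by apply: lt_le_trans hA _; rewrite -lecR !Re_sum sum_fsubset.
Qed.

End Sums.

(** * The Hilbert space of square summable functions *)

Section L2.
Variables (R : realType) (I : choiceType).
Local Notation C := R[i].

Definition l2_pred : {pred (I -> C^o)} := fun f =>
  `[< exists M : C, forall A : {fset I}, \sum_(i <- A) `|f i| ^+ 2 <= M >].

(** The parallelogram law with one term dropped. *)
Lemma normD_sqr_le (x y : C) : `|x + y| ^+ 2 <= 2 * (`|x| ^+ 2 + `|y| ^+ 2).
Proof.
have -> : 2 * (`|x| ^+ 2 + `|y| ^+ 2) = `|x + y| ^+ 2 + `|x - y| ^+ 2.
  by rewrite !normCK !(rmorphD, rmorphN) /=; ring.
by rewrite lerDl exprn_ge0.
Qed.

Lemma l2_closed : submod_closed l2_pred.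
Proof.
split=> [|a f g /asboolP[M hM] /asboolP[N hN]]; apply/asboolP.
  by exists 0 => A; rewrite big1 // => i _; rewrite normr0 expr0n.
exists (2 * (`|a| ^+ 2 * M + N)) => A.
apply: (@le_trans _ _ (\sum_(i <- A) 2 * (`|a| ^+ 2 * `|f i| ^+ 2 + `|g i| ^+ 2))).
  apply: ler_sum => i _; apply: le_trans (normD_sqr_le _ _) _.
  by rewrite normrM exprMn.
rewrite -mulr_sumr ler_pM2l // big_split /= -mulr_sumr lerD //.
by rewrite ler_wpM2l ?exprn_ge0.
Qed.

HB.instance Definition _ := GRing.isSubmodClosed.Build C (I -> C^o)
  l2_pred l2_closed.

Record l2 := L2 { l2_fun :> I -> C^o; _ : l2_fun \in l2_pred }.

HB.instance Definition _ := [isSub for l2_fun].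
HB.instance Definition _ := [Choice of l2 by <:].
HB.instance Definition _ := [SubChoice_isSubLmodule of l2 by <:].

Implicit Types f g h : l2.

Lemma l2_lin (a : C) f g i : (a *: f + g) i = a * f i + g i.
Proof. by []. Qed.

Lemma l2_inj f g : (forall i, f i = g i) -> f = g.
Proof. by move=> fg; apply/val_inj/funext. Qed.

Lemma l2_sqr_sum f : exists l, has_sum (fun i => `|f i| ^+ 2 : C) l.
Proof.
have /asboolP[M hM] := valP f.
by apply: (@bounded_has_sum _ _ _ M) => // i; rewrite exprn_ge0.
Qed.

(** Reduces the convergence of inner products to that of square sums. The
    products by 1 and -1 are kept so that each term has the shape of a value of
    a linear combination [a *: f + g]. *)
Lemma polarize (x y : C) : x * Num.conj y =
  4^-1 * (`|1 * x + y| ^+ 2 + (- `|(-1) * x + y| ^+ 2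
   + ('i%R * `|(-'i%R) * x + y| ^+ 2 + (- 'i%R * `|'i%R * x + y| ^+ 2)))).
Proof.
rewrite !normCK !(rmorphD, rmorphN, rmorphM) /= rmorph1 conjCi.
have := sqrCi C; move: 'i%R (Num.conj x) (Num.conj y) => i x' y' i2.
apply: (@mulfI _ (4%:R : C)); first by rewrite pnatr_eq0.
rewrite mulVKf ?pnatr_eq0 //.
by ring: i2.
Qed.

Lemma l2_prod_sum f g : exists l, has_sum (fun i => f i * Num.conj (g i) : C) l.
Proof.
have [l1 h1] := l2_sqr_sum (1 *: f + g).
have [l2 /(has_sumZ (-1)) h2] := l2_sqr_sum ((-1) *: f + g).
have [l3 /(has_sumZ 'i%R) h3] := l2_sqr_sum (- 'i%R *: f + g).
have [l4 /(has_sumZ (- 'i%R)) h4] := l2_sqr_sum ('i%R *: f + g).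
have := has_sumZ 4^-1 (has_sumD h1 (has_sumD h2 (has_sumD h3 h4))).
set l := (X in has_sum _ X) => h; exists l; move: h.
by congr has_sum; apply/funext => i; rewrite mulN1r; symmetry; exact: polarize.
Qed.

Definition l2_dot f g : C := projT1 (cid (l2_prod_sum f g)).

Lemma l2_dotP f g : has_sum (fun i => f i * Num.conj (g i) : C) (l2_dot f g).
Proof. exact: projT2 (cid _). Qed.

Lemma l2_dotE f g l :
  has_sum (fun i => f i * Num.conj (g i) : C) l -> l2_dot f g = l.
Proof. exact/has_sum_unique/l2_dotP. Qed.

Lemma l2_dot_herm f g : l2_dot f g = (-1) ^+ false * Num.conj (l2_dot g f).
Proof.
rewrite expr0 mul1r; apply: l2_dotE; have := has_sumJ (l2_dotP g f).
by congr has_sum; apply/funext => i; rewrite rmorphM /= conjCK mulrC.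
Qed.

Lemma l2_dot_linl g : linear_for *%R (l2_dot ^~ g).
Proof.
move=> a f h; apply: l2_dotE.
have := has_sumD (has_sumZ a (l2_dotP f g)) (l2_dotP h g).
by congr has_sum; apply/funext => i; rewrite l2_lin mulrDl mulrA.
Qed.

Lemma l2_dot_linr f : linear_for (Num.conj \; *%R) (l2_dot f).
Proof.
have E g : Num.conj (l2_dot g f) = l2_dot f g.
  by rewrite [RHS]l2_dot_herm expr0 mul1r.
by move=> a g h; rewrite -!E l2_dot_linl rmorphD rmorphM.
Qed.

HB.instance Definition _ := bilinear_isBilinear.Build C l2 l2 C
  *%R (Num.conj \; *%R) l2_dot (l2_dot_linl, l2_dot_linr).
HB.instance Definition _ := isHermitianSesquilinear.Build C l2 false
  Num.conj l2_dot l2_dot_herm.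

(** With [l2_dot_le], says that the inner square is the least upper bound of
    the finite square sums; the estimates of norms go through these two bounds instead of
    through limits. *)
Lemma l2_sqr_le f (A : {fset I}) : \sum_(i <- A) `|f i| ^+ 2 <= l2_dot f f.
Proof.
apply: sum_le_has_sum => [|i]; last by rewrite exprn_ge0.
by have := l2_dotP f f; congr has_sum; apply/funext => i; rewrite normCK.
Qed.

Lemma l2_dot_le f (M : C) :
  (forall A : {fset I}, \sum_(i <- A) `|f i| ^+ 2 <= M) -> l2_dot f f <= M.
Proof.
move=> hM; apply: (has_sum_le (l2_dotP f f)) => A; apply: le_trans (hM A).
by apply: ler_sum => i _; rewrite normCK.
Qed.

Lemma l2_dot_pos f : f != 0 -> 0 < l2_dot f f.
Proof.
move=> f0; have [i fi] : exists i, f i != 0.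
  apply: contrapT => /forallNP h; case/negP: f0; apply/eqP/l2_inj => i.
  by apply/eqP; have /negP := h i; rewrite negbK.
apply: lt_le_trans (l2_sqr_le f [fset i]%fset).
by rewrite big_seq_fset1 exprn_gt0 // normr_gt0.
Qed.

HB.instance Definition _ := isDotProduct.Build C l2 l2_dot l2_dot_pos.

Definition l2_form : {dot l2 for (@Num.conj C)} := l2_dot.

End L2.

Lemma real_complete (R : realType) (u : nat -> R) :
  (forall e, 0 < e -> exists N, forall m n,
     (N <= m)%N -> (N <= n)%N -> `|u m - u n| < e) ->
  exists l, forall e, 0 < e -> exists N, forall n, (N <= n)%N -> `|u n - l| < e.
Proof.
move=> hu.
have /cauchy_cvgP/cvg_ex[l hl] : cauchy (u @ \oo)%classic.
  apply: cauchy_exP => e e0; have [N hN] := hu e e0.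
  exists (u N); exists N => // n /= Nn; rewrite /ball /=; exact: hN.
exists l => e e0; have /cvgrPdist_lt/(_ e e0)[N _ hN] := hl.
by exists N => n Nn; rewrite distrC; exact: hN.
Qed.

Lemma norm_split (R : realType) (z : R[i]) :
  `|z| <= (`|complex.Re z| + `|complex.Im z|)%:C.
Proof.
rewrite {1}[z]complexE; apply: le_trans (ler_normD _ _) _.
rewrite normrM complexiE normCi mul1r rmorphD lerD //=;
  by rewrite !normc_def /= expr0n /= addr0 sqrtr_sqr.
Qed.

Lemma complex_norm_complete (R : realType) : norm_complete (fun z : R[i] => `|z|).
Proof.
move=> u hu.
have Re_le (z : R[i]) : `|complex.Re z|%:C <= `|z| := normc_ge_Re z.
have Im_le (z : R[i]) : `|complex.Im z|%:C <= `|z|.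
  have := normc_ge_Re (z * 'i%C).
  by rewrite ReiNIm normrN normrM complexiE normCi mulr1.
have [a ha] : exists a, forall e, 0 < e -> exists N, forall n, (N <= n)%N ->
    `|complex.Re (u n) - a| < e.
  apply: real_complete => e e0; have [|N hN] := hu e%:C; first by rewrite ltcR.
  exists N => m n Nm Nn; rewrite -raddfB -ltcR.
  exact: le_lt_trans (Re_le _) (hN m n Nm Nn).
have [b hb] : exists b, forall e, 0 < e -> exists N, forall n, (N <= n)%N ->
    `|complex.Im (u n) - b| < e.
  apply: real_complete => e e0; have [|N hN] := hu e%:C; first by rewrite ltcR.
  exists N => m n Nm Nn; rewrite -raddfB -ltcR.
  exact: le_lt_trans (Im_le _) (hN m n Nm Nn).
exists (a +i* b) => e e0.
have eR : (complex.Re e)%:C = e by apply: RRe_real; exact: gtr0_real.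
have e2 : 0 < complex.Re e / 2 by rewrite divr_gt0 // -ltcR eR.
have [N1 h1] := ha _ e2; have [N2 h2] := hb _ e2.
exists (maxn N1 N2) => n; rewrite geq_max => /andP[n1 n2].
apply: le_lt_trans (norm_split _) _; rewrite -eR ltcR !raddfB /= [ltRHS]splitr.
by rewrite ltrD ?h1 ?h2.
Qed.

Section L2complete.
Variables (R : realType) (I : choiceType).
Local Notation C := R[i].
Implicit Types f g h : l2 R I.

(** Removes the square root from the definition of the Hilbert norm. *)
Lemma hnorm_lt f (e : C) : 0 < e ->
  (hnorm (l2_form R I) f < e) = (l2_dot f f < e ^+ 2).
Proof.
move=> e0; have f0 : 0 <= l2_dot f f.
  by apply: le_trans (l2_sqr_le f fset0); rewrite big_seq_fset0.
by rewrite /hnorm -[LHS](@ltr_pXn2r _ 2%N) ?nnegrE ?sqrtC_ge0 ?(ltW e0) //= sqrtCK.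
Qed.

(** The usual proof: a Cauchy sequence converges at each point, and the square
    sums of u n - l over a finite set are bounded uniformly in that set, by
    comparison with u n - u m for m large depending on the set. *)
Lemma l2_complete : norm_complete (hnorm (l2_form R I)).
Proof.
move=> u hu.
have eval_lt f i (e : C) : 0 < e -> hnorm (l2_form R I) f < e -> `|f i| < e.
  move=> e0; rewrite hnorm_lt // => fe.
  rewrite -(@ltr_pXn2r _ 2%N) ?nnegrE ?(ltW e0) //; apply: le_lt_trans fe.
  by have := l2_sqr_le f [fset i]%fset; rewrite big_seq_fset1.
have [i|l hl] := @choice _ _ (fun i (li : C) => forall e : C, 0 < e ->
    exists N, forall n, (N <= n)%N -> `|(u n i : C) - li| < e).
  apply: complex_norm_complete => e e0; have [N hN] := hu e e0.
  by exists N => m n Nm Nn; exact: (eval_lt _ i e e0 (hN m n Nm Nn)).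
(* Pointwise convergence is uniform on finite sets. *)
have sum_lt (s : seq I) (d : C) : 0 < d -> exists M, forall m, (M <= m)%N ->
    \sum_(i <- s) `|u m i - l i| ^+ 2 < d.
  elim: s d => [|i s IH] d d0; first by exists 0%N => m _; rewrite big_nil.
  have d2 : 0 < d / 2 by rewrite divr_gt0.
  have [M1 h1] := IH _ d2.
  have [|M2 h2] := hl i (sqrtC (d / 2)); first by rewrite sqrtC_gt0.
  exists (maxn M1 M2) => m; rewrite geq_max => /andP[m1 m2].
  rewrite big_cons [ltRHS]splitr ltrD ?h1 // -[ltRHS]sqrtCK.
  by rewrite ltr_pXn2r ?nnegrE ?sqrtC_ge0 ?(ltW d2) // h2.
have bound (e : C) : 0 < e -> exists N, forall n, (N <= n)%N ->
    forall A : {fset I}, \sum_(i <- A) `|u n i - l i| ^+ 2 <= e ^+ 2.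
  move=> e0; have e2 : 0 < e / 2 by rewrite divr_gt0.
  have [N hN] := hu _ e2; exists N => n Nn A.
  have [M hM] := sum_lt A _ (exprn_gt0 2 e2).
  pose m := maxn N M.
  have hm := hN n m Nn (leq_maxl _ _); rewrite hnorm_lt // in hm.
  (* The factor 2 lost in |x + y|^2 <= 2 (|x|^2 + |y|^2) is absorbed by
     running the Cauchy condition with e / 2. *)
  have -> : e ^+ 2 = 2 * ((e / 2) ^+ 2 + (e / 2) ^+ 2) by field.
  apply: (@le_trans _ _ (\sum_(i <- A)
    2 * (`|(u n - u m) i| ^+ 2 + `|u m i - l i| ^+ 2))).
    apply: ler_sum => i _; apply: le_trans (normD_sqr_le _ _).
    by rewrite subrKA.
  rewrite -mulr_sumr ler_pM2l // big_split /= lerD //.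
    exact: le_trans (l2_sqr_le _ _) (ltW hm).
  exact/ltW/hM/leq_maxr.
have [N1 hN1] := bound 1 ltr01.
have lP : (l : I -> C^o) \in @l2_pred R I.
  have -> : (l : I -> C^o) = (l2_fun (u N1) : I -> C^o) - ((u N1 : I -> C^o) - l).
    by apply/funext => i; rewrite /= opprB addrC subrK.
  apply: rpredB; first exact: valP.
  by apply/asboolP; exists (1 ^+ 2) => A; exact: hN1.
exists (L2 lP) => e e0; have e2 : 0 < e / 2 by rewrite divr_gt0.
have [N hN] := bound _ e2; exists N => n Nn; rewrite hnorm_lt //.
apply: (@le_lt_trans _ _ ((e / 2) ^+ 2)); first by apply: l2_dot_le => A; exact: hN.
rewrite ltr_pXn2r ?nnegrE ?(ltW e0) ?(ltW e2) // [ltRHS]splitr.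
by rewrite ltrDl.
Qed.

End L2complete.

(** * The left regular representation and the independence of the delta_s *)

Section RegularRepresentation.
Variables (R : realType) (G : groupType).
Local Notation C := R[i].

Lemma shift_subproof (s : G) (f : l2 R G) :
  (fun h => f (s^-1 * h)%g : C^o) \in @l2_pred R G.
Proof.
have /asboolP[M hM] := valP f; apply/asboolP; exists M => A.
apply: le_trans (hM [fset (s^-1 * h)%g | h in A]%fset).
by rewrite big_imfset //= => x y _ _; exact: mulgI.
Qed.

(** The left regular representation: translation by s moves the point mass at
    h to the point mass at s h. *)
Definition shift (s : G) (f : l2 R G) : l2 R G := L2 (shift_subproof s f).

Lemma dirac_subproof (s : G) : (fun h => (h == s)%:R : C^o) \in @l2_pred R G.
Proof.
apply/asboolP; exists 1 => A.
apply: (sum_le_has_sum (l := 1)) => [|i]; last by rewrite exprn_ge0.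
have := has_sum1 s (1 : C); congr has_sum; apply/funext => h.
by case: eqP; rewrite ?normr1 ?normr0 ?expr0n ?expr1n.
Qed.

Definition dirac (s : G) : l2 R G := L2 (dirac_subproof s).

Lemma shift_unitary : unitary_rep (l2_form R G) shift.
Proof.
split; first exact: l2_complete.
- by move=> s a f g; apply: l2_inj.
- by move=> f; apply: l2_inj => h /=; rewrite invg1 mul1g.
- by move=> s t f; apply: l2_inj => h /=; rewrite invgM mulgA.
move=> s f g; rewrite /l2_form /=; apply: l2_dotE.
exact: (has_sum_reindex (mulVKg s) (mulKg s) (l2_dotP f g)).
Qed.

Lemma dirac_dot s : l2_dot (dirac s) (dirac s) = 1.
Proof.
apply: l2_dotE; have := has_sum1 s (1 : C); congr has_sum.
by apply/funext => h; rewrite /= rmorph_nat -natrM mulnb andbb.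
Qed.

(** The universal norm dominates the norm in the left regular representation,
    where the element sum a s delta_s moves the point mass at 1 to the function
    a; if the element vanishes, so does a. *)
Lemma delta_free (A : cstarAlgebraType R) (delta : G -> A) (F : seq G)
    (a : G -> C) : is_group_cstar delta -> uniq F ->
  \sum_(s <- F) a s *: delta s = 0 -> forall s, s \in F -> a s = 0.
Proof.
move=> hA uF h0 g gF; have [hub _] := delta_norm hA F a.
have c0 : cnorm (0 : A) = 0 by rewrite -(scale0r 0) cnormZ normr0 mul0r.
set v := \sum_(s <- F) a s *: shift s (dirac 1).
have /hub : rep_norms F a (hnorm (l2_form R G) v).
  exists (l2 R G), (l2_form R G), shift, (dirac 1); split => //.
    exact: shift_unitary.
  by rewrite /hnorm /l2_form /= dirac_dot sqrtC1.
rewrite h0 c0 => hv.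
have v0 : v = 0.
  apply/eqP; apply: contraT => /l2_dot_pos; rewrite -sqrtC_gt0 => vpos.
  by have := lt_le_trans vpos hv; rewrite ltxx.
have ev (w : seq G) : (\sum_(s <- w) a s *: shift s (dirac 1) : l2 R G) g
    = \sum_(s <- w) a s * (s^-1 * g == 1)%g%:R.
  by elim: w => [|s w IH]; rewrite ?big_nil // !big_cons -IH.
have := ev F; rewrite -/v v0 (bigD1_seq g) //= mulVg eqxx mulr1 big1.
  by rewrite addr0 => <-.
move=> s /negPf sg; rewrite -(inj_eq (mulgI s)) mulVKg mulg1 eq_sym sg.
by rewrite mulr0.
Qed.

End RegularRepresentation.

(** * Positive semidefinite matrices *)

Section Forms.
Variables (C : numClosedFieldType) (I : finType).
Implicit Types (M : I -> I -> C) (u v w : I -> C).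

(** Matrices are handled as functions on an arbitrary finite index set, so that
    block matrices are simply matrices indexed by pairs. *)
Definition sform M u w : C := \sum_a \sum_b Num.conj (u a) * M a b * w b.

Definition psd M := forall w, 0 <= sform M w w.

Lemma eq_psd M M' : (forall a b, M a b = M' a b) -> psd M -> psd M'.
Proof. by move=> MM'; rewrite (_ : M = M') //; do 2 apply/funext => ?. Qed.

Lemma sform_comb M (c : C) u w :
  sform M (fun a => c * u a + w a) (fun a => c * u a + w a) =
  `|c| ^+ 2 * sform M u u + Num.conj c * sform M u w + c * sform M w u
  + sform M w w.
Proof.
rewrite /sform !mulr_sumr -!big_split /=; apply: eq_bigr => a _.
rewrite !mulr_sumr -!big_split /=; apply: eq_bigr => b _.
rewrite normCK rmorphD rmorphM /=.
by ring.
Qed.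

Definition units4 : seq C := [:: 1; -1; 'i%R; - 'i%R].

(** Since the four c sum to zero, and so do their squares and the c |c|^2, only
    the terms c * conj c of the expansion survive. *)
Lemma sform_polarization M u w : 4 * sform M u w =
  \sum_(c <- units4) c * sform M (fun a => c * u a + w a) (fun a => c * u a + w a).
Proof.
rewrite !big_cons big_nil !sform_comb !normCK !rmorphN /= !rmorph1 !conjCi addr0.
by have := sqrCi C; move: 'i%R => i i2; ring: i2.
Qed.

(** With x = sform M u w and y = sform M w u, the expansions of the form at
    u + w and at i u + w show that x + y and i (y - x) are real; hence
    y = conj x. *)
Lemma psd_herm M : psd M -> forall u w, sform M w u = Num.conj (sform M u w).
Proof.
move=> hM u w.
have h c : Num.conj c * sform M u w + c * sform M w u \is Num.real.
  have -> : Num.conj c * sform M u w + c * sform M w u =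
      sform M (fun a => c * u a + w a) (fun a => c * u a + w a)
      - `|c| ^+ 2 * sform M u u - sform M w w by rewrite sform_comb; ring.
  by rewrite !realB ?realM ?realX ?normr_real ?ger0_real.
move: (h 1) (h 'i%R) => /CrealP e1 /CrealP ei; move: e1 ei.
move: (sform M u w) (sform M w u) => x y.
rewrite rmorph1 !mul1r conjCi !(rmorphD, rmorphM, rmorphN) /= conjCi.
have := sqrCi C; move: (Num.conj x) (Num.conj y) 'i%R => x' y' i i2 e1 ei.
apply: (@mulfI _ (2 : C)); first by rewrite pnatr_eq0.
have -> : 2 * y = (x + y) - i * (- i * x + i * y) by ring: i2.
by rewrite -e1 -ei; ring: i2.
Qed.

Lemma sform_delta M a b :
  sform M (fun x => (x == a)%:R) (fun x => (x == b)%:R) = M a b.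
Proof.
rewrite /sform (bigD1 a) //= (bigD1 b) //= !eqxx rmorph1 mul1r mulr1.
rewrite big1 ?addr0 => [|i /negPf->]; last by rewrite mulr0.
rewrite big1 ?addr0 // => i /negPf->; apply: big1 => j _.
by rewrite rmorph0 !mul0r.
Qed.

Lemma sformD M N w :
  sform (fun a b => M a b + N a b) w w = sform M w w + sform N w w.
Proof.
rewrite /sform -big_split; apply: eq_bigr => a _; rewrite -big_split.
by apply: eq_bigr => b _; rewrite mulrDr mulrDl.
Qed.

Lemma sformZ (c : C) M w : sform (fun a b => c * M a b) w w = c * sform M w w.
Proof.
rewrite /sform mulr_sumr; apply: eq_bigr => a _; rewrite mulr_sumr.
by apply: eq_bigr => b _; rewrite mulrCA !mulrA.
Qed.

Lemma sform_adj M w :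
  sform (fun a b => Num.conj (M b a)) w w = Num.conj (sform M w w).
Proof.
rewrite /sform rmorph_sum exchange_big; apply: eq_bigr => a _ /=.
rewrite rmorph_sum; apply: eq_bigr => b _ /=.
by rewrite !rmorphM /= conjCK mulrC mulrA mulrAC.
Qed.

Lemma sform_id (c : C) w :
  sform (fun a b => c * (a == b)%:R) w w = c * \sum_a `|w a| ^+ 2.
Proof.
rewrite /sform mulr_sumr; apply: eq_bigr => a _.
rewrite (bigD1 a) //= eqxx mulr1 big1 ?addr0 => [|b]; first by rewrite normCK; ring.
by rewrite eq_sym => /negPf->; rewrite mulr0 mulr0 mul0r.
Qed.

(** Crude, but enough to make a large multiple of the identity dominate any
    given matrix. *)
Lemma sform_bound M w :
  `|sform M w w| <= (\sum_a \sum_b `|M a b|) * \sum_a `|w a| ^+ 2.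
Proof.
set N := \sum_a `|w a| ^+ 2.
have le_N a : `|w a| ^+ 2 <= N.
  by rewrite /N (bigD1 a) //= lerDl sumr_ge0 // => i _; rewrite exprn_ge0.
rewrite mulr_suml; apply: le_trans (ler_norm_sum _ _ _) _; apply: ler_sum => a _.
rewrite mulr_suml; apply: le_trans (ler_norm_sum _ _ _) _; apply: ler_sum => b _.
rewrite !normrM norm_conjC mulrAC [leRHS]mulrC ler_wpM2r //.
rewrite -(@ler_pM2l _ 2) //.
apply: (@le_trans _ _ (`|w a| ^+ 2 + `|w b| ^+ 2)); last first.
  by rewrite mulr_natl mulr2n lerD.
rewrite -subr_ge0.
have -> : `|w a| ^+ 2 + `|w b| ^+ 2 - 2 * (`|w a| * `|w b|)
  = (`|w a| - `|w b|) ^+ 2 by ring.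
by rewrite -realEsqr realB // normr_real.
Qed.

End Forms.

Lemma sform_pair (C : numClosedFieldType) (I J : finType)
    (M : I * J -> I * J -> C) w :
  sform M w w = \sum_k \sum_s \sum_l \sum_t
    Num.conj (w (k, s)) * M (k, s) (l, t) * w (l, t).
Proof.
rewrite pair_bigA; apply: eq_bigr => -[k s] _; rewrite pair_bigA.
by apply: eq_bigr => -[l t].
Qed.

Lemma sform_reindex (C : numClosedFieldType) (I J : finType) (h : J -> I)
    (M : I -> I -> C) w : bijective h ->
  sform M w w = sform (fun a b => M (h a) (h b)) (w \o h) (w \o h).
Proof.
move=> hb; rewrite /sform (reindex h) /=; last exact: onW_bij.
by apply: eq_bigr => a _; rewrite (reindex h) //; exact: onW_bij.
Qed.

Lemma psd_reindex (C : numClosedFieldType) (I J : finType) (h : J -> I)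
    (M : I -> I -> C) : bijective h ->
  psd M <-> psd (fun a b => M (h a) (h b)).
Proof.
move=> [k hk kh]; split=> hM w; last by rewrite (sform_reindex _ _ (Bijective hk kh)).
rewrite (_ : w = (w \o k) \o h); first by rewrite -sform_reindex //; exists k.
by apply/funext => a; rewrite /= hk.
Qed.

Section PsdFactor.
Variable C : numClosedFieldType.
Local Open Scope sesquilinear_scope.

(** Spectral theorem: V is the unitary that diagonalizes M times the square
    root of the diagonal part. *)
Lemma psd_mx_factor n (M : 'M[C]_n) : psd M ->
  exists V : 'M[C]_n, M = V *m V ^t*.
Proof.
move=> hM.
have Mherm : M \is hermsymmx.
  apply/is_hermitianmxP; rewrite expr0 scale1r; apply/matrixP => i j.
  by rewrite !mxE -(sform_delta M i j) -(sform_delta M j i); exact: psd_herm.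
have /orthomx_spectralP := hermitian_normalmx Mherm.
set P := spectralmx M; set D := spectral_diag M => ME.
have PU : P \is unitarymx := spectral_unitarymx M.
rewrite invmx_unitary // in ME.
have PP : P *m P ^t* = 1%:M by apply/unitarymxP.
have D0 i : 0 <= D 0 i.
  have <- : sform M (fun j => Num.conj (P i j)) (fun j => Num.conj (P i j)) = D 0 i.
    transitivity ((P *m M *m P ^t*) i i).
      rewrite mxE /sform exchange_big /=; apply: eq_bigr => b _.
      rewrite !mxE mulr_suml; apply: eq_bigr => a _.
      by rewrite conjCK.
    rewrite ME !mulmxA PP mul1mx -mulmxA PP mulmx1.
    by rewrite mxE eqxx mulr1n.
  exact: hM.
exists (P ^t* *m diag_mx (\row_i sqrtC (D 0 i))).
rewrite trmx_mul map_mxM map_trmx trmxK tr_diag_mx map_diag_mx.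
rewrite -map_mx_comp (map_mx_id (@conjCK _)) mulmxA -[X in X *m P]mulmxA.
rewrite mulmx_diag ME; congr (_ *m diag_mx _ *m _).
apply/rowP => i; rewrite !mxE. rewrite /= geC0_conj ?sqrtC_ge0 //.
by rewrite -expr2 sqrtCK.
Qed.

Lemma psd_factor (I : finType) (M : I -> I -> C) : psd M ->
  exists V : I -> I -> C, forall a b, M a b = \sum_c V a c * Num.conj (V b c).
Proof.
move=> hM; have /psd_mx_factor[V hV] :
    psd (\matrix_(i < #|I|, j < #|I|) M (enum_val i) (enum_val j)).
  have hb := psd_reindex M (@enum_val_bij I).
  apply: eq_psd (hb.1 hM) => a b; by rewrite mxE.
exists (fun a b => V (enum_rank a) (enum_rank b)) => a b.
have /matrixP/(_ (enum_rank a) (enum_rank b)) := hV.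
rewrite !mxE !enum_rankK => ->; rewrite (reindex (@enum_rank I)) /=.
  by apply: eq_bigr => c _; rewrite !mxE.
exact/onW_bij/enum_rank_bij.
Qed.

End PsdFactor.

(** * M. Riesz's extension theorem *)

Section Riesz.
Variables (R : realType) (V : lmodType R[i]) (P : V -> Prop).
Hypothesis P_add : forall x y, P x -> P y -> P (x + y).
Hypothesis P_scale : forall (a : R) x, 0 <= a -> P x -> P (a%:C *: x).

(** A real-linear functional on a subspace is represented by its graph K, a
    subspace of V * R. When 0 is in P, positivity forces K to be single-valued:
    if (0, r) is in K, then r and - r are nonnegative. So a vector can be added
    to the domain without asking whether it is already there. *)
Definition positive_graph (K : V -> R -> Prop) : Prop :=
  [/\ forall x r y s, K x r -> K y s -> K (x + y) (r + s),
      forall (a : R) x r, K x r -> K (a%:C *: x) (a * r)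
    & forall x r, K x r -> P x -> 0 <= r].

Variables (u : V) (ru : R).
Hypothesis u_unit : forall x, exists c : R, P (c%:C *: u + x).

(** One step of M. Riesz's extension theorem. The value t at x has to satisfy
    - r <= t for every (y, r) in K with y + x in P, and t <= r for every (y, r)
    in K with y - x in P. Each lower bound is below each upper bound because
    the sum of the two vectors is a positive vector of the domain; the order
    unit u shows that there are bounds of both kinds. *)
Lemma extend_positive_graph (K : V -> R -> Prop) (x : V) :
  positive_graph K -> K u ru ->
  exists K' t, [/\ positive_graph K', forall y r, K y r -> K' y r & K' x t].
Proof.
move=> [K_add K_scale K_pos] Ku.
pose E : set R := [set r | exists2 y, K y (- r) & P (y + x)]%classic.
have E0 : (E !=set0)%classic.
  have [c hc] := u_unit x; exists (- (c * ru)), (c%:C *: u) => //.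
  by rewrite opprK; exact: K_scale.
have E_le y r : K y r -> P (y - x) -> ubound E r.
  move=> Kyr Py s [z Kzs Pz]; rewrite -subr_ge0; apply: (K_pos (y + z)).
    exact: K_add.
  have -> : y + z = (y - x) + (z + x) by rewrite addrACA addNr addr0.
  exact: P_add.
have Eub : has_ubound E.
  have [c hc] := u_unit (- x); exists (c * ru).
  by apply: (E_le (c%:C *: u)) => //; exact: K_scale.
pose t := sup E.
exists (fun z q => exists y r a, [/\ K y r, z = y + a%:C *: x & q = r + a * t]), t.
split; last first.
- exists (0%:C *: u), (0 * ru), 1; split; first exact: K_scale.
    by rewrite scale0r add0r scale1r.
  by rewrite mul0r add0r mul1r.
- by move=> y r Kyr; exists y, r, 0; rewrite scale0r mul0r !addr0.
split.
- move=> _ _ _ _ [y [r [a [Kyr -> ->]]]] [z [s [b [Kzs -> ->]]]].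
  exists (y + z), (r + s), (a + b); split; first exact: K_add.
    by rewrite addrACA -scalerDl rmorphD.
  by rewrite addrACA mulrDl.
- move=> b _ _ [y [r [a [Kyr -> ->]]]].
  exists (b%:C *: y), (b * r), (b * a); split; first exact: K_scale.
    by rewrite scalerDr scalerA rmorphM.
  by rewrite mulrDr mulrA.
move=> _ _ [y [r [a [Kyr -> ->]]]] Pz.
have [a0|a0|a0] := ltgtP a 0.
- have Na : 0 < - a by rewrite oppr_gt0.
  have le_t : t <= (- a)^-1 * r.
    apply: ge_sup => //; apply: (E_le ((- a)^-1%:C *: y)); first exact: K_scale.
    have -> : (- a)^-1%:C *: y - x = (- a)^-1%:C *: (y + a%:C *: x).
      rewrite scalerDr scalerA -rmorphM /= invrN mulNr mulVf ?lt_eqF //.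
      by rewrite [(- 1)%:C]rmorphN rmorph1 scaleN1r.
    by apply: P_scale => //; rewrite invr_ge0 ltW.
  rewrite mulrC ler_pdivlMr // in le_t.
  have -> : r + a * t = r - t * - a by ring.
  by rewrite subr_ge0.
- suff le_t : - (a^-1 * r) <= t.
    by rewrite -(ler_pM2l a0) mulrN mulVKf ?gt_eqF // -subr_ge0 opprK addrC in le_t.
  apply: ub_le_sup => //; exists (a^-1%:C *: y).
    by rewrite opprK; exact: K_scale.
  have -> : a^-1%:C *: y + x = a^-1%:C *: (y + a%:C *: x).
    by rewrite scalerDr scalerA -rmorphM /= mulVf ?gt_eqF // scale1r.
  by apply: P_scale => //; rewrite invr_ge0 ltW.
rewrite a0 mul0r addr0; apply: (K_pos _ _ Kyr).
by rewrite a0 scale0r addr0 in Pz.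
Qed.

Lemma extend_positive_graph_seq (K : V -> R -> Prop) (s : seq V) :
  positive_graph K -> K u ru ->
  exists K', [/\ positive_graph K', forall y r, K y r -> K' y r
    & forall x, x \in s -> exists t, K' x t].
Proof.
elim: s K => [|x s IH] K hK Ku; first by exists K; split.
have [K1 [t [hK1 KK1 K1x]]] := extend_positive_graph x hK Ku.
have [K2 [hK2 K12 K2s]] := IH K1 hK1 (KK1 _ _ Ku).
exists K2; split=> // [y r /KK1/K12//|y]; rewrite inE => /predU1P[->|/K2s//].
by exists t; exact: K12.
Qed.

End Riesz.

(** The graph is extended to the real basis consisting of the coordinate
    vectors and their multiples by i. A real-linear functional on J -> C is the
    real part of a unique complex-linear one, given by the coefficients c. *)
Lemma riesz_extension (R : realType) (J : finType) (P : (J -> R[i]^o) -> Prop)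
    (K : (J -> R[i]^o) -> R -> Prop) (u : J -> R[i]^o) (ru : R) :
  (forall x y, P x -> P y -> P (x + y)) ->
  (forall (a : R) x, 0 <= a -> P x -> P (a%:C *: x)) ->
  (forall x, exists c : R, P (c%:C *: u + x)) ->
  positive_graph P K -> K u ru ->
  exists c : J -> R[i],
    (forall x, P x -> 0 <= complex.Re (\sum_j x j * c j)) /\
    (forall x r, K x r -> r = complex.Re (\sum_j x j * c j)).
Proof.
move=> P_add P_scale u_unit hK Ku.
pose e (j : J) (z : R[i]) : J -> R[i]^o := fun k => z *+ (k == j).
have [K' [[K_add K_scale K_pos] KK' K'e]] :=
  extend_positive_graph_seq P_add P_scale u_unit
    [seq e p.1 p.2 | p <- [seq (j, z) | j <- enum J, z <- [:: 1; 'i%C]]] hK Ku.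
have K'ex (p : J * bool) : exists r, K' (e p.1 (if p.2 then 'i%C else 1)) r.
  case: p => j b; apply: K'e; apply/mapP; exists (j, if b then 'i%C else 1) => //.
  apply/allpairsP; exists (j, if b then 'i%C else 1); split=> //=.
    by rewrite mem_enum.
  by rewrite !inE; case: b; rewrite eqxx ?orbT.
have [t ht] := choice K'ex.
(* Re ((p + i q) (a - i b)) = p a + q b. *)
pose c j : R[i] := t (j, false) -i* t (j, true).
have K'0 : K' 0 0.
  by have := K_scale 0 _ _ (KK' _ _ Ku); rewrite scale0r mul0r.
have K'c (x : J -> R[i]^o) : K' x (complex.Re (\sum_j x j * c j)).
  have xE : x = \sum_j
      ((complex.Re (x j))%:C *: e j 1 + (complex.Im (x j))%:C *: e j 'i%C).
    have ev j k (a b : R[i]) : (a *: e j 1 + b *: e j 'i%C) k = (a + 'i%C * b) *+ (k == j).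
      transitivity (a * (1 *+ (k == j)) + b * ('i%C *+ (k == j))) => //.
      by case: (k == j); rewrite ?mulr0n ?mulr0 ?addr0 // !mulr1n mulr1 (mulrC b).
    apply/funext => k; rewrite fct_sumE (bigD1 k) //= ev eqxx -complexE.
    by rewrite big1 ?addr0 // => j; rewrite ev eq_sym => /negPf->.
  have -> : complex.Re (\sum_j x j * c j) =
      \sum_j (complex.Re (x j) * t (j, false) + complex.Im (x j) * t (j, true)).
    rewrite raddf_sum; apply: eq_bigr => j _; rewrite /c; case: (x j) => a b /=.
    by rewrite mulrN opprK.
  rewrite {1}xE.
  elim/big_ind2: _ => [//|y r z q|j _]; first exact: K_add.
  by apply: K_add; apply: K_scale; [exact: (ht (j, false))|exact: (ht (j, true))].
exists c; split=> [x|x r /KK' Kxr]; first exact: K_pos.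
have P0 : P 0.
  have [d hd] := u_unit 0; have := P_scale 0 _ (lexx 0) hd.
  by rewrite scale0r.
have K0 := K_add _ _ _ _ Kxr (K_scale (-1) _ _ (K'c x)).
rewrite rmorphN rmorph1 scaleN1r subrr mulN1r in K0.
have K0' := K_scale (-1) _ _ K0; rewrite scaler0 mulN1r opprB in K0'.
by apply/eqP; rewrite eq_le -[_ <= r]subr_ge0 -subr_ge0 (K_pos _ _ K0) ?(K_pos _ _ K0').
Qed.

(** * Matrix cones as positive forms *)

Section Cones.
Variable R : realType.
Local Notation C := R[i].

Lemma posmx_psd n (M : 'M[C]_n) : posmx M <-> psd M.
Proof.
have E (v : 'cV[C]_n) : ((map_mx Num.conj v)^T *m M *m v) 0 0 =
    sform M (v ^~ 0) (v ^~ 0).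
  rewrite mxE /sform exchange_big /=; apply: eq_bigr => b _.
  by rewrite mxE mulr_suml; apply: eq_bigr => a _; rewrite !mxE.
split=> hM w; last by rewrite E.
have := hM (\col_i w i); rewrite E; congr (0 <= _).
by apply: eq_bigr => a _; apply: eq_bigr => b _; rewrite !mxE.
Qed.

(** Flattening a block matrix is a relabelling of indices. *)
Lemma matrix_mcone_psd m n (M : 'M['M[C]_m]_n) :
  mcone n M <-> psd (fun a b : 'I_n * 'I_m => M a.1 b.1 a.2 b.2).
Proof.
pose h (a : 'I_n * 'I_m) := tagnat.Rank (p_ := fun=> m) a.1 a.2.
have hb : bijective h.
  apply: (@Bijective _ _ _ (fun i => (tagnat.sig1 i, tagnat.sig2 (p_ := fun=> m) i))).
    move=> [i j]; rewrite /h /=; congr pair; first exact: tagnat.Rank1K.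
    by rewrite tagnat.Rank2K; apply: val_inj.
  by move=> i; rewrite /h /= tagnat.sig2K.
rewrite [mcone n M]/(posmx _).
apply: iff_trans (posmx_psd _) _; apply: iff_trans (psd_reindex _ hb) _.
suff -> : (fun a b => (\mxblock_(i < n, j < n) M i j) (h a) (h b)) =
    (fun a b : 'I_n * 'I_m => M a.1 b.1 a.2 b.2) by [].
apply/funext => a; apply/funext => b; rewrite /h.
by have /matrixP/(_ a.2 b.2) := mxblockK M a.1 b.1; rewrite mxE.
Qed.

(** Evaluation of the form at the vector sum_k e_k (x) e_k. This is how
    complete positivity of a matrix of functionals is turned into positivity of
    a single functional on matrices. *)
Lemma psd_pair_diag n (M : 'I_n -> 'I_n -> 'I_n -> 'I_n -> C) :
  psd (fun a b : 'I_n * 'I_n => M a.1 b.1 a.2 b.2) ->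
  0 <= \sum_k \sum_l M k l k l.
Proof.
move=> /(_ (fun a => (a.1 == a.2)%:R)); congr (0 <= _).
have collapse (F : 'I_n * 'I_n -> C) :
    (forall a, a.1 != a.2 -> F a = 0) -> \sum_a F a = \sum_k F (k, k).
  move=> F0; have -> : \sum_a F a = \sum_k \sum_l F (k, l).
    by rewrite pair_bigA; apply: eq_bigr => -[].
  apply: eq_bigr => k _.
  rewrite (bigD1 k) //= big1 ?addr0 // => l kl.
  by apply: F0; rewrite /= eq_sym.
rewrite /sform collapse => [|a /negPf->]; last first.
  by apply: big1 => b _; rewrite rmorph0 !mul0r.
apply: eq_bigr => k _; rewrite collapse => [|a /negPf->]; last by rewrite mulr0.
by apply: eq_bigr => l _; rewrite /= !eqxx rmorph1 mul1r mulr1.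
Qed.

(** With B_x the matrix with entries B x s k, the new matrix is
    sum_x (B_x (x) 1) T (B_x (x) 1)^*, so its form at w is the sum over x of
    the form of T at (B_x (x) 1)^* w. *)
Lemma psd_compress (X J K S : finType) (T : J -> J -> S -> S -> C)
    (B : X -> S -> K -> C) :
  psd (fun a b : J * S => T a.1 b.1 a.2 b.2) ->
  psd (fun a b : K * J => \sum_s \sum_t
    (\sum_x B x s a.1 * Num.conj (B x t b.1)) * T a.2 b.2 s t).
Proof.
move=> hT w.
pose v x (b : J * S) := \sum_l Num.conj (B x b.2 l) * w (l, b.1).
suff -> : sform (fun a b : K * J => \sum_s \sum_t
    (\sum_x B x s a.1 * Num.conj (B x t b.1)) * T a.2 b.2 s t) w w =
    \sum_x sform (fun a b : J * S => T a.1 b.1 a.2 b.2) (v x) (v x).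
  by apply: sumr_ge0 => x _; exact: hT.
(* Both sides are sums of F over the same seven indices, in different orders. *)
pose F (x : X) (s t : S) (k l : K) (i j : J) :=
  Num.conj (w (k, i)) * (B x s k * Num.conj (B x t l) * T i j s t) * w (l, j).
transitivity (\sum_(q : (K * J) * (K * J) * S * S * X)
    F q.2 q.1.1.2 q.1.2 q.1.1.1.1.1 q.1.1.1.2.1 q.1.1.1.1.2 q.1.1.1.2.2).
  rewrite -(pair_bigA _ (fun q x =>
    F x q.1.2 q.2 q.1.1.1.1 q.1.1.2.1 q.1.1.1.2 q.1.1.2.2)) /=.
  rewrite -(pair_bigA _ (fun q t =>
    \sum_x F x q.2 t q.1.1.1 q.1.2.1 q.1.1.2 q.1.2.2)) /=.
  rewrite -(pair_bigA _ (fun q s => \sum_t \sum_x F x s t q.1.1 q.2.1 q.1.2 q.2.2)) /=.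
  rewrite /sform [LHS]pair_bigA /=; apply: eq_bigr => q _.
  rewrite mulr_sumr mulr_suml; apply: eq_bigr => s _.
  rewrite mulr_sumr mulr_suml; apply: eq_bigr => t _.
  rewrite mulr_suml mulr_sumr mulr_suml; apply: eq_bigr => x _.
  by case: q => -[k i] [l j].
transitivity (\sum_(q : X * (J * S) * (J * S) * K * K)
    F q.1.1.1.1 q.1.1.1.2.2 q.1.1.2.2 q.1.2 q.2 q.1.1.1.2.1 q.1.1.2.1).
  pose h (q : X * (J * S) * (J * S) * K * K) : (K * J) * (K * J) * S * S * X :=
    let: (x, (i, s), (j, t), k, l) := q in (k, i, (l, j), s, t, x).
  pose h' (q : (K * J) * (K * J) * S * S * X) : X * (J * S) * (J * S) * K * K :=
    let: (k, i, (l, j), s, t, x) := q in (x, (i, s), (j, t), k, l).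
  rewrite (reindex h) /=; first by apply: eq_bigr => -[[[[x [i s]] [j t]] k] l] _.
  by exists h' => [[[[[x [i s]] [j t]] k] l] _|[[[[[k i] [l j]] s] t] x] _].
rewrite -(pair_bigA _ (fun q l =>
  F q.1.1.1 q.1.1.2.2 q.1.2.2 q.2 l q.1.1.2.1 q.1.2.1)) /=.
rewrite -(pair_bigA _ (fun q k => \sum_l F q.1.1 q.1.2.2 q.2.2 k l q.1.2.1 q.2.1)) /=.
rewrite -(pair_bigA _ (fun q b => \sum_k \sum_l F q.1 q.2.2 b.2 k l q.2.1 b.1)) /=.
rewrite -(pair_bigA _ (fun x a => \sum_b \sum_k \sum_l F x a.2 b.2 k l a.1 b.1)) /=.
apply: eq_bigr => x _; apply: eq_bigr => a _; apply: eq_bigr => b _.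
rewrite /v rmorph_sum !mulr_suml; apply: eq_bigr => k _.
rewrite mulr_sumr; apply: eq_bigr => l _.
rewrite rmorphM /= conjCK /F.
by move: (Num.conj (w _)) (Num.conj (B _ _ _)) => c1 c2; ring.
Qed.

End Cones.

(** * The pairing of Toeplitz matrices with sums of squares *)

(** Collects the terms of a sum according to the value of g; with
    g (s, t) = s t^-1 it gathers the coefficients of each delta_d. *)
Lemma regroup (K : pzRingType) (V : lmodType K) (D : eqType) (P : finType)
    (g : P -> D) (a : P -> K) (F : D -> V) :
  \sum_p a p *: F (g p) =
  \sum_(d <- undup (codom g)) (\sum_(p | g p == d) a p) *: F d.
Proof.
transitivity (\sum_(d <- undup (codom g)) \sum_(p | g p == d) a p *: F (g p)).
  under [RHS]eq_bigr do rewrite big_mkcond.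
  rewrite exchange_big /=; apply: eq_bigr => p _; rewrite -big_mkcond /=.
  rewrite -big_filter; have -> : [seq d <- undup (codom g) | g p == d] = [:: g p].
    rewrite (eq_filter (a2 := pred1 (g p))) => [|d]; last exact: eq_sym.
    by apply: filter_pred1_uniq; rewrite ?undup_uniq // mem_undup codom_f.
  by rewrite big_seq1.
apply: eq_bigr => d _; rewrite scaler_suml.
by apply: eq_bigr => p /eqP->.
Qed.

Section Duals.
Variables (R : realType) (X : matrixOrderedType R).
Local Notation C := R[i].

Lemma positive_in_dual (p : X -> C^o) :
  positive_functional p -> p \in @dual_pred R X.
Proof.
move=> hp; apply/asboolP; exists 1%N, (fun=> 1), (fun=> p); split=> //.
by rewrite big_ord1 scale1r.
Qed.

Lemma dual_linear (f : dual X) : linear f.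
Proof.
have /asboolP[r [c [p [hp fE]]]] := valP f.
move=> a x y; rewrite -![dual_fun f _]/(val f _) fE.
rewrite !fct_sumE scaler_sumr -big_split; apply: eq_bigr => k _ /=.
have [lin _] := hp k.
rewrite -![(c k *: p k) _]/(c k *: p k _) lin scalerDr !scalerA.
by rewrite (mulrC (c k)).
Qed.

Lemma dual_ext (f g : dual X) : (forall x, f x = g x) -> f = g.
Proof. by move=> fg; apply/val_inj/funext. Qed.

Lemma dual0 (f : dual X) : f 0 = 0.
Proof.
by apply: (addIr (f 0)); rewrite add0r -{1}[f 0]scale1r -dual_linear scale1r addr0.
Qed.

Lemma dual_sum (f : dual X) (I : finType) (c : I -> C) (x : I -> X) :
  f (\sum_i c i *: x i) = \sum_i c i * f (x i).
Proof.
elim/big_rec2: _ => [|i y z _ <-]; first exact: dual0.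
by rewrite dual_linear.
Qed.

End Duals.

Section Pairing.
Variables (R : realType) (G : groupType).
Variables (A : cstarAlgebraType R) (delta : G -> A) (hA : is_group_cstar delta).
Variable (S : {fset G}).
Local Notation C := R[i].
Local Notation Tp := (toeplitz R S).
Local Notation SOS := (sos delta S).
Local Notation quo p := (val p.1 * (val p.2)^-1)%g.
Implicit Types (T : Tp) (x : SOS).

Lemma toeplitz_entry T (s1 t1 s2 t2 : S) :
  quo (s1, t1) = quo (s2, t2) -> entry T s1 t1 = entry T s2 t2.
Proof. by have /toeplitz_predP := valP T; apply. Qed.

Lemma toeplitz_ext T T' : (forall s t, entry T s t = entry T' s t) -> T = T'.
Proof.
move=> h; apply/val_inj/matrixP => i j.
by have := h (enum_val i) (enum_val j); rewrite /entry !enum_valK.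
Qed.

(** Entries that depend only on s t^-1 are the entries of a Toeplitz matrix;
    all Toeplitz matrices below are obtained from this. *)
Lemma toeplitz_exists (F : S -> S -> C) :
  (forall s1 t1 s2 t2, quo (s1, t1) = quo (s2, t2) -> F s1 t1 = F s2 t2) ->
  exists T, forall s t, entry T s t = F s t.
Proof.
move=> hF; pose M : 'M[C]_#|{: S}| := \matrix_(i, j) F (enum_val i) (enum_val j).
have ME s t : entry M s t = F s t by rewrite /entry mxE !enum_rankK.
have MP : M \in @toeplitz_pred R G S.
  by apply/toeplitz_predP => s1 t1 s2 t2 e; rewrite !ME; exact: hF.
by exists (Toeplitz MP).
Qed.

Definition sos_sum (c : S -> S -> C) : A :=
  \sum_s \sum_t c s t *: delta (val s * (val t)^-1)%g.

Definition toeplitz_sum (c : S -> S -> C) (T : Tp) : C :=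
  \sum_s \sum_t c s t * entry T s t.

Lemma sos_sum_pair (c : S -> S -> C) :
  sos_sum c = \sum_(p : S * S) c p.1 p.2 *: delta (quo p).
Proof. by rewrite /sos_sum pair_bigA. Qed.

Lemma toeplitz_sum_pair (c : S -> S -> C) T :
  toeplitz_sum c T = \sum_(p : S * S) c p.1 p.2 * entry T p.1 p.2.
Proof. by rewrite /toeplitz_sum pair_bigA. Qed.

Lemma toeplitz_indicator (d : G) :
  exists T, forall s t, entry T s t = (quo (s, t) == d)%:R.
Proof. by apply: toeplitz_exists => s1 t1 s2 t2 ->. Qed.

(** The annihilator of the Toeplitz matrices in the space of all S * S arrays
    is the space of relations between the delta_{s t^-1}: both consist of the
    c whose sum over each fibre of (s, t) |-> s t^-1 vanishes. For the Toeplitz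
    matrices this is tested on the indicators of the fibres, and for the
    elements delta_d it is their linear independence. *)
Lemma sos_sum_eq0 (c : S -> S -> C) :
  sos_sum c = 0 <-> forall T, toeplitz_sum c T = 0.
Proof.
pose g (p : S * S) : G := quo p.
pose cd d := \sum_(p | g p == d) c p.1 p.2.
have cdE d : (forall T, toeplitz_sum c T = 0) -> cd d = 0.
  move=> h; have [T hT] := toeplitz_indicator d.
  rewrite -(h T) toeplitz_sum_pair /cd big_mkcond; apply: eq_bigr => p _.
  by rewrite hT -/(g (p.1, p.2)); case: p => s t /=; case: eqP; rewrite ?mulr1 ?mulr0.
split=> [|h]; last first.
  by rewrite sos_sum_pair (regroup g) big1 // => d _; rewrite -/(cd d) cdE // scale0r.
rewrite sos_sum_pair (regroup g) => /(delta_free hA (undup_uniq _)) h T.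
pose tau d : C^o := if [pick p | g p == d] is Some p then entry T p.1 p.2 else 0.
have tauE p : entry T p.1 p.2 = tau (g p).
  rewrite /tau; case: pickP => [q /eqP|/(_ p)]; last by rewrite eqxx.
  by case: p q => s t [s' t'] /= e; exact/toeplitz_entry/esym.
rewrite toeplitz_sum_pair; under eq_bigr do rewrite tauE.
rewrite (regroup g (fun p => c p.1 p.2) tau) big_seq big1 // => d /h->.
by rewrite scale0r.
Qed.

Lemma sos_exists (c : S -> S -> C) : exists x, sos_val x = sos_sum c.
Proof.
have cP : sos_sum c \in sos_pred delta S by apply/asboolP; exists c.
by exists (Sos cP).
Qed.

Lemma sos_coef_subproof x : exists c, sos_val x = sos_sum c.
Proof. by have /asboolP := valP x. Qed.

(** The value of phi_T at x. Coordinates of x along the delta_{s t^-1} are not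
    unique; by [sos_sum_eq0] the choice does not matter. *)
Definition pairing T x : C :=
  toeplitz_sum (projT1 (cid (sos_coef_subproof x))) T.

Lemma sos_sumB (c d : S -> S -> C) :
  sos_sum c - sos_sum d = sos_sum (fun s t => c s t - d s t).
Proof.
rewrite /sos_sum -sumrB; apply: eq_bigr => s _; rewrite -sumrB.
by apply: eq_bigr => t _; rewrite scalerBl.
Qed.

Lemma toeplitz_sumB (c d : S -> S -> C) T :
  toeplitz_sum c T - toeplitz_sum d T = toeplitz_sum (fun s t => c s t - d s t) T.
Proof.
rewrite /toeplitz_sum -sumrB; apply: eq_bigr => s _; rewrite -sumrB.
by apply: eq_bigr => t _; rewrite mulrBl.
Qed.

(** Says both that the pairing is well defined and that it separates the
    elements of SOS(S). *)
Lemma pairingP x (c : S -> S -> C) :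
  sos_val x = sos_sum c <-> forall T, pairing T x = toeplitz_sum c T.
Proof.
rewrite /pairing; case: cid => d /= ->; split=> [/eqP|h].
  rewrite -subr_eq0 sos_sumB => /eqP/sos_sum_eq0 h T.
  by apply/eqP; rewrite -subr_eq0 toeplitz_sumB h.
apply/eqP; rewrite -subr_eq0 sos_sumB; apply/eqP/sos_sum_eq0 => T.
by rewrite -toeplitz_sumB h subrr.
Qed.

Lemma pairingE x : exists2 c, sos_val x = sos_sum c &
  forall T, pairing T x = toeplitz_sum c T.
Proof. by have [c hc] := sos_coef_subproof x; exists c => //; exact/pairingP. Qed.

Lemma pairing_linl x : linear_for *%R (pairing ^~ x).
Proof.
move=> a T U; have [c _ h] := pairingE x; rewrite !h /toeplitz_sum.
rewrite mulr_sumr -big_split; apply: eq_bigr => s _.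
rewrite mulr_sumr -big_split; apply: eq_bigr => t _.
rewrite [entry (toeplitz_val (a *: T + U)) s t](_ : _ = a * entry T s t + entry U s t).
  by rewrite /=; ring.
by rewrite /entry !mxE.
Qed.

Lemma pairingDl T U x : pairing (T + U) x = pairing T x + pairing U x.
Proof. by rewrite -[T]scale1r pairing_linl scale1r mul1r. Qed.

Lemma pairingZl a T x : pairing (a *: T) x = a * pairing T x.
Proof.
have p0 : pairing 0 x = 0.
  by have := pairing_linl x (-1) 0 0; rewrite scaler0 addr0 mulN1r addNr.
by rewrite -[a *: T]addr0 pairing_linl p0 addr0.
Qed.

Lemma pairingBl T U x : pairing (T - U) x = pairing T x - pairing U x.
Proof. by rewrite pairingDl -scaleN1r pairingZl mulN1r. Qed.

Lemma pairing_linr T : linear_for *%R (pairing T).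
Proof.
move=> a x y; have [c cx hx] := pairingE x; have [d dy hy] := pairingE y.
have /pairingP-> : sos_val (a *: x + y) = sos_sum (fun s t => a * c s t + d s t).
  rewrite [LHS](_ : _ = a *: sos_val x + sos_val y) // cx dy /sos_sum.
  rewrite scaler_sumr -big_split; apply: eq_bigr => s _.
  rewrite scaler_sumr -big_split; apply: eq_bigr => t _.
  by rewrite scalerDl scalerA.
rewrite hx hy /toeplitz_sum.
rewrite mulr_sumr -big_split; apply: eq_bigr => s _.
rewrite mulr_sumr -big_split; apply: eq_bigr => t _.
by rewrite mulrDl mulrA.
Qed.

Lemma pairing_delta T s t : pairing T (sos_delta delta s t) = entry T s t.
Proof.
have /pairingP-> : sos_val (sos_delta delta s t) =
    sos_sum (fun s' t' => ((s', t') == (s, t))%:R).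
  rewrite sos_sum_pair (bigD1 (s, t)) //= eqxx scale1r big1 ?addr0 //.
  by move=> [s' t'] /= /negPf->; rewrite scale0r.
rewrite toeplitz_sum_pair (bigD1 (s, t)) //= eqxx mul1r big1 ?addr0 //.
by move=> [s' t'] /= /negPf->; rewrite mul0r.
Qed.

Lemma pairing_inj x y : (forall T, pairing T x = pairing T y) -> x = y.
Proof.
move=> h; have [c cy hy] := pairingE y; apply: val_inj.
by rewrite /= cy; apply/pairingP => T; rewrite h hy.
Qed.

Lemma sos_decomp x (c : S -> S -> C) : sos_val x = sos_sum c ->
  x = \sum_(p : S * S) c p.1 p.2 *: sos_delta delta p.1 p.2.
Proof. by move=> hc; apply: val_inj; rewrite raddf_sum /= hc sos_sum_pair. Qed.

End Pairing.

(** * Positivity of the pairing *)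

Section Positivity.
Variables (R : realType) (G : groupType).
Variables (A : cstarAlgebraType R) (delta : G -> A) (hA : is_group_cstar delta).
Variable (S : {fset G}).
Local Notation C := R[i].
Local Notation Tp := (toeplitz R S).
Local Notation SOS := (sos delta S).

Lemma adj_sum (I : finType) (c : I -> C) (x : I -> A) :
  adj (\sum_i c i *: x i) = \sum_i Num.conj (c i) *: adj (x i).
Proof.
have adj0 : adj (0 : A) = 0.
  have := adjZD 1 (0 : A) 0; rewrite scale1r addr0 rmorph1 scale1r => h.
  by apply: (addIr (adj (0 : A))); rewrite -h add0r.
by elim/big_rec2: _ => [//|i y z _ <-]; rewrite adjZD.
Qed.

(** Expands y y^* using delta_s delta_t^* = delta_{s t^-1}. *)
Lemma sos_mconeP n (N : 'M[SOS]_n) : mcone n N <->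
  exists r (B : 'I_r -> S -> 'M[C]_n), forall k l,
    sos_val (N k l) = sos_sum delta (fun s t =>
      \sum_(x : 'I_r * 'I_n) B x.1 s k x.2 * Num.conj (B x.1 t l x.2)).
Proof.
have entryE r (B : 'I_r -> S -> 'M[C]_n) k l :
    (\sum_(q < r) (\sum_(s : S) tensmx (B q s) (delta (val s))) *m
       adjmx (\sum_(s : S) tensmx (B q s) (delta (val s)))) k l =
    sos_sum delta (fun s t =>
      \sum_(x : 'I_r * 'I_n) B x.1 s k x.2 * Num.conj (B x.1 t l x.2)).
  have yE q i p : (\sum_(s : S) tensmx (B q s) (delta (val s))) i p =
      \sum_(s : S) B q s i p *: delta (val s).
    by rewrite summxE; apply: eq_bigr => s _; rewrite mxE.
  rewrite summxE /sos_sum.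
  under eq_bigr do rewrite mxE.
  under [RHS]eq_bigr do under eq_bigr do rewrite scaler_suml.
  rewrite [LHS]pair_bigA.
  under [RHS]eq_bigr do rewrite exchange_big.
  rewrite [RHS]exchange_big; apply: eq_bigr => -[q p] _ /=.
  rewrite !mxE !yE adj_sum mulr_suml; apply: eq_bigr => s _.
  rewrite mulr_sumr; apply: eq_bigr => t _.
  by rewrite -scalerAl -scalerAr scalerA (deltaM hA) (deltaV hA).
split=> [[r [B /matrixP hN]]|[r [B hN]]]; exists r, B.
  by move=> k l; rewrite -entryE -hN mxE.
by apply/matrixP => k l; rewrite entryE -hN mxE.
Qed.

Lemma entryD (T U : Tp) s t : entry (T + U) s t = entry T s t + entry U s t.
Proof. by rewrite /entry mxE. Qed.

Lemma entryN (T : Tp) s t : entry (- T) s t = - entry T s t.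
Proof. by rewrite /entry mxE. Qed.

Lemma entryZ a (T : Tp) s t : entry (a *: T) s t = a * entry T s t.
Proof. by rewrite /entry mxE. Qed.

Lemma entry_lin a (T U : Tp) s t :
  entry (a *: T + U) s t = a * entry T s t + entry U s t.
Proof. by rewrite entryD entryZ. Qed.

Lemma entry_toeplitz1 s t : entry (toeplitz1 R S) s t = (s == t)%:R.
Proof. by rewrite /entry mxE (inj_eq enum_rank_inj). Qed.

Lemma toeplitz_mcone_psd n (T : 'M[Tp]_n) : mcone n T <->
  psd (fun a b : 'I_n * S => entry (T a.1 b.1) a.2 b.2).
Proof.
rewrite [mcone n T]/(mcone n (map_mx (@toeplitz_val R G S) T)).
pose h (a : 'I_n * S) : 'I_n * 'I_#|{: S}| := (a.1, enum_rank a.2).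
have hb : bijective h.
  exists (fun a => (a.1, enum_val a.2)) => -[i s]; rewrite /h /=.
    by rewrite enum_rankK.
  by rewrite enum_valK.
apply: iff_trans (matrix_mcone_psd _) _; apply: iff_trans (psd_reindex _ hb) _.
suff -> : (fun a b : 'I_n * S =>
    map_mx (@toeplitz_val R G S) T (h a).1 (h b).1 (h a).2 (h b).2) =
  (fun a b : 'I_n * S => entry (T a.1 b.1) a.2 b.2) by [].
by apply/funext => a; apply/funext => b; rewrite mxE.
Qed.

(** The source of the positivity of both maps: pairing T with y y^* compresses
    the positive block matrix T by the coefficients of y. *)
Lemma pairing_psd m n (T : 'M[Tp]_m) (N : 'M[SOS]_n) : mcone m T -> mcone n N ->
  psd (fun a b : 'I_n * 'I_m => pairing (T a.2 b.2) (N a.1 b.1)).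
Proof.
move=> /toeplitz_mcone_psd hT /sos_mconeP[r [B hN]].
have := @psd_compress R ('I_r * 'I_n)%type 'I_m 'I_n S (fun i j s t => entry (T i j) s t)
  (fun x s k => B x.1 s k x.2) hT.
congr psd; apply/funext => a; apply/funext => b.
by have /(pairingP hA)-> := hN a.1 b.1.
Qed.

(** The first two terms contribute twice a real part to the form, which is
    bounded below by - 2 |sform M w w|. *)
Lemma psd_hermitize (I : finType) (M : I -> I -> C) : psd (fun a b =>
  M a b + Num.conj (M b a) + 2 * (\sum_a \sum_b `|M a b|) * (a == b)%:R).
Proof.
move=> w; set c := \sum_a \sum_b `|M a b|.
rewrite (sformD (fun a b => M a b + Num.conj (M b a))) sformD sform_adj sform_id.
have := sform_bound M w; rewrite -/c; set z := sform M w w; set B := c * _ => zB.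
have xr : z + Num.conj z \is Num.real by apply/CrealP; rewrite rmorphD /= conjCK addrC.
have : `|z + Num.conj z| <= 2 * B.
  apply: le_trans (ler_normD _ _) _; rewrite norm_conjC.
  by rewrite mulr_natl mulr2n lerD.
rewrite real_ler_norml // => /andP[+ _].
by rewrite -mulrA -/B -subr_ge0 opprK.
Qed.

(** U is the adjoint of T and V a multiple of the identity. So Toeplitz systems
    contain enough positive elements: T + U and i (T - U), hence T, are
    combinations of them. *)
Lemma toeplitz_hermitize n (T : 'M[Tp]_n) : exists U V : 'M[Tp]_n,
  [/\ mcone n (T + U + V), mcone n V,
      mcone n (\matrix_(k, l) ('i%R *: (T k l - U k l)) + V)
    & forall k l s t, entry (U k l) s t = Num.conj (entry (T l k) t s)].
Proof.
pose M (a b : 'I_n * S) := entry (T a.1 b.1) a.2 b.2.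
pose c := 2 * \sum_a \sum_b `|M a b|.
have c0 : 0 <= c by rewrite mulr_ge0 ?sumr_ge0 // => a _; rewrite sumr_ge0.
have U_ex (p : 'I_n * 'I_n) : exists u : Tp, forall s t,
    entry u s t = Num.conj (entry (T p.2 p.1) t s).
  apply: toeplitz_exists => s1 t1 s2 t2 e; congr Num.conj.
  apply: toeplitz_entry => /=.
  by apply: (can_inj invgK); rewrite !invgM !invgK.
have [U hU] := choice U_ex.
exists (\matrix_(k, l) U (k, l)).
exists (\matrix_(k, l) (c * (k == l)%:R *: toeplitz1 R S)).
have VE k l s t : entry ((\matrix_(k, l) (c * (k == l)%:R *: toeplitz1 R S)) k l : Tp) s t =
    c * ((k, s) == (l, t))%:R.
  rewrite mxE [LHS]entryZ entry_toeplitz1 xpair_eqE -mulrA -natrM mulnb.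
  by [].
split.
- apply/toeplitz_mcone_psd; apply: eq_psd (psd_hermitize M) => -[k s] [l t] /=.
  by rewrite mxE entryD VE mxE entryD mxE hU.
- apply/toeplitz_mcone_psd.
  apply: (@eq_psd _ _ (fun a b => c * (a == b)%:R)) => [[k s] [l t]|w]; first by rewrite VE.
  by rewrite sform_id mulr_ge0 // sumr_ge0 // => a _; rewrite exprn_ge0.
- apply/toeplitz_mcone_psd.
  apply: eq_psd (psd_hermitize (fun a b => 'i%R * M a b)) => -[k s] [l t] /=.
  have -> : \sum_a \sum_b `|'i%R * M a b| = \sum_a \sum_b `|M a b|.
    by apply: eq_bigr => a _; apply: eq_bigr => b _; rewrite normrM normCi mul1r.
  rewrite mxE entryD VE mxE entryZ entryD entryN mxE hU rmorphM /= conjCi.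
  by rewrite mulrBr mulNr.
by move=> k l s t; rewrite mxE hU.
Qed.

End Positivity.

(** * The Toeplitz system as a dual *)

(** Recovers T from the three positive elements of [toeplitz_hermitize]. *)
Lemma hermitian_parts_split (C : numClosedFieldType) (t u v : C) :
  t = 2^-1 * (t + u + v - (1 - 'i) * v - 'i%R * ('i%R * (t - u) + v)).
Proof.
apply: (@mulfI _ (2 : C)); first by rewrite pnatr_eq0.
by rewrite mulVKf ?pnatr_eq0 //; have := sqrCi C; move: 'i%R => i i2; ring: i2.
Qed.

Section DualMaps.
Variables (R : realType) (G : groupType).
Variables (A : cstarAlgebraType R) (delta : G -> A) (hA : is_group_cstar delta).
Variable (S : {fset G}).
Local Notation C := R[i].
Local Notation Tp := (toeplitz R S).
Local Notation SOS := (sos delta S).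

Lemma toeplitz_psd1 (T : Tp) : mcone 1 (const_mx T) -> psd (entry T).
Proof.
have hb : bijective (fun s : S => (0 : 'I_1, s)).
  by exists snd => // -[i s]; rewrite ord1.
move=> /toeplitz_mcone_psd/(psd_reindex _ hb); apply: eq_psd => s t.
by rewrite /= mxE.
Qed.

Lemma pairing_positive (P : 'M[Tp]_1) : mcone 1 P ->
  positive_functional (pairing (P 0 0) : SOS -> C^o).
Proof.
move=> hP; split=> [|x hx]; first exact: (pairing_linr hA).
have := psd_pair_diag (M := fun k l i j =>
  pairing (P i j) ((const_mx x : 'M[SOS]_1) k l)) (pairing_psd hA hP hx).
by rewrite !big_ord1 mxE.
Qed.

Lemma toeplitz_to_dual_subproof (T : Tp) : (pairing T : SOS -> C^o) \in @dual_pred R SOS.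
Proof.
have [U [V [h1 h2 h3 _]]] := toeplitz_hermitize (const_mx T : 'M[Tp]_1).
pose P1 := (const_mx T + U + V) 0 0.
pose P2 := (\matrix_(k, l) ('i%R *: ((const_mx T : 'M[Tp]_1) k l - U k l)) + V) 0 0.
have -> : (pairing T : SOS -> C^o) = 2^-1 *: (pairing P1
    - (1 - 'i%R) *: pairing (V 0 0) - 'i%R *: pairing P2 : SOS -> C^o).
  apply/funext => x.
  transitivity (2^-1 * (pairing P1 x - (1 - 'i%R) * pairing (V 0 0) x
      - 'i%R * pairing P2 x)) => //.
  rewrite /P1 /P2 !mxE !(pairingBl hA, pairingZl hA, pairingDl hA).
  exact: hermitian_parts_split.
apply: rpredZ; apply: rpredB; last exact/rpredZ/positive_in_dual/pairing_positive.
apply: rpredB; last exact/rpredZ/positive_in_dual/pairing_positive.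
exact/positive_in_dual/pairing_positive.
Qed.

Definition toeplitz_to_dual (T : Tp) : dual SOS := Dual (toeplitz_to_dual_subproof T).

(** By polarization, the functional T |-> entry T s t is a combination of the
    positive functionals T |-> <T v, v> with v = z e_s + e_t. *)
Lemma sos_to_dual_subproof (x : SOS) :
  ((fun T => pairing T x) : Tp -> C^o) \in @dual_pred R Tp.
Proof.
have [c _ hc] := pairingE hA x.
pose q (z : C) (s t : S) : Tp -> C^o := fun T =>
  sform (entry T) (fun a => z * (a == s)%:R + (a == t)%:R)
    (fun a => z * (a == s)%:R + (a == t)%:R).
have q_pos z s t : positive_functional (q z s t).
  split=> [a T U|T hT].
    rewrite /q /sform scaler_sumr -big_split; apply: eq_bigr => i _ /=.
    rewrite scaler_sumr -big_split; apply: eq_bigr => j _ /=.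
    rewrite (entry_lin a T U) -[a *: _]/(a * _).
    by move: (Num.conj _) => w; ring.
  exact: toeplitz_psd1 hT _.
have -> : ((fun T => pairing T x) : Tp -> C^o) =
    \sum_s \sum_t (c s t / 4) *: (\sum_(z <- units4 C) z *: q z s t : Tp -> C^o).
  apply/funext => T; rewrite hc /toeplitz_sum fct_sumE; apply: eq_bigr => s _.
  rewrite fct_sumE; apply: eq_bigr => t _.
  rewrite -(sform_delta (entry T) s t).
  transitivity (c s t / 4 * \sum_(z <- units4 C) z * q z s t T).
    by rewrite -sform_polarization mulrA divfK ?pnatr_eq0.
  by rewrite -[RHS]/(c s t / 4 * _) fct_sumE.
apply: rpred_sum => s _; apply: rpred_sum => t _; apply: rpredZ.
by apply: rpred_sum => z _; apply: rpredZ; exact: positive_in_dual.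
Qed.

Definition sos_to_dual (x : SOS) : dual Tp := Dual (sos_to_dual_subproof x).

Lemma toeplitz_to_dual_linear : linear toeplitz_to_dual.
Proof. by move=> a T U; apply: dual_ext => x; exact: pairing_linl. Qed.

Lemma sos_to_dual_linear : linear sos_to_dual.
Proof. by move=> a x y; apply: dual_ext => T; exact: (pairing_linr hA). Qed.

Lemma toeplitz_to_dual_cp : completely_positive toeplitz_to_dual.
Proof.
split; first exact: toeplitz_to_dual_linear.
move=> n T hT; split=> [a x y|m N hN].
  apply/matrixP => i j; rewrite !mxE; exact: (pairing_linr hA).
apply/matrix_mcone_psd; apply: eq_psd (pairing_psd hA hT hN) => a b.
by rewrite !mxE.
Qed.

Lemma sos_to_dual_cp : completely_positive sos_to_dual.
Proof.
split; first exact: sos_to_dual_linear.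
move=> n N hN; split=> [a x y|m T hT].
  apply/matrixP => i j; rewrite !mxE; exact: pairing_linl.
apply/matrix_mcone_psd.
have hb : bijective (fun a : 'I_m * 'I_n => (a.2, a.1)).
  by exists (fun a => (a.2, a.1)) => -[].
apply: eq_psd ((psd_reindex _ hb).1 (pairing_psd hA hT hN)) => a b.
by rewrite !mxE.
Qed.

Lemma sos_functional_toeplitz (f : dual SOS) :
  exists T : Tp, forall s t, entry T s t = f (sos_delta delta s t).
Proof.
apply: toeplitz_exists => s1 t1 s2 t2 e; congr (f _).
by apply: val_inj; rewrite /= e.
Qed.

(** The inverse sends f to the matrix f (delta_{s t^-1}). It preserves the cones
    because the form of that matrix at w is obtained by applying f to the
    square y y^*, where y is the column with entries
    y_k = sum_s conj (w (k, s)) delta_s, and summing over all k and l. *)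
Lemma toeplitz_to_dual_iso : complete_order_iso toeplitz_to_dual.
Proof.
split; first exact: toeplitz_to_dual_cp.
have [psi hpsi] := choice sos_functional_toeplitz.
exists psi.
have phiK : cancel toeplitz_to_dual psi.
  by move=> T; apply: toeplitz_ext => s t; rewrite hpsi /=; exact: (pairing_delta hA T s t).
have psiK : cancel psi toeplitz_to_dual.
  move=> f; apply: dual_ext => x.
  have [c /sos_decomp->] := sos_coef_subproof x.
  rewrite !dual_sum; apply: eq_bigr => p _; congr (_ * _).
  by rewrite -(hpsi f); exact: (pairing_delta hA (psi f) p.1 p.2).
split=> //; split=> [a f g|n f [_ hf]].
  by apply: (can_inj phiK); rewrite psiK toeplitz_to_dual_linear !psiK.
apply/toeplitz_mcone_psd => w.
case: n f hf w => [|n] f hf w; first by rewrite /sform big1 // => -[[]].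
have N_ex (p : 'I_n.+1 * 'I_n.+1) : exists x : SOS, sos_val x =
    sos_sum delta (fun s t => Num.conj (w (p.1, s)) * w (p.2, t)).
  exact: sos_exists.
have [N hN] := choice N_ex.
have /hf/matrix_mcone_psd hfN : mcone n.+1 (\matrix_(k, l) N (k, l)).
  apply/(sos_mconeP hA); exists 1%N.
  (* A single column, placed in column 0 of a square matrix. *)
  exists (fun _ s => \matrix_(k, j) (Num.conj (w (k, s)) *+ (j == 0))) => k l.
  rewrite mxE hN /sos_sum; apply: eq_bigr => s _; apply: eq_bigr => t _.
  congr (_ *: _); rewrite (bigD1 (0, 0)) //= big1 => [|[q j]].
    by rewrite !mxE !eqxx !mulr1n conjCK addr0.
  rewrite xpair_eqE ord1 eqxx /= => /negPf j0.
  by rewrite mxE j0 mulr0n mul0r.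
have := psd_pair_diag (M := fun k l i j => f i j (N (k, l))).
rewrite (_ : \sum_k _ = sform (fun a b : 'I_n.+1 * S =>
    entry (map_mx psi f a.1 b.1) a.2 b.2) w w).
  apply; apply: eq_psd hfN => a b; by rewrite !mxE.
rewrite sform_pair; apply: eq_bigr => k _; rewrite [RHS]exchange_big.
apply: eq_bigr => l _; rewrite (sos_decomp (hN (k, l))) dual_sum pair_bigA.
by apply: eq_bigr => p _; rewrite mxE hpsi mulrAC.
Qed.

End DualMaps.

(** * The sums-of-squares system as a dual *)

Section InverseDual.
Variables (R : realType) (G : groupType).
Variables (A : cstarAlgebraType R) (delta : G -> A) (hA : is_group_cstar delta).
Variable (S : {fset G}).
Local Notation C := R[i].
Local Notation Tp := (toeplitz R S).
Local Notation SOS := (sos delta S).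

Lemma entry_sum (I : finType) (c : I -> C) (X : I -> Tp) s t :
  entry (\sum_i c i *: X i : Tp) s t = \sum_i c i * entry (X i) s t.
Proof.
elim/big_rec2: _ => [|i y z _ <-]; first by rewrite /entry mxE.
by rewrite entryD entryZ.
Qed.

(** T is the sum of its entries times the indicators of the fibres of
    (s, t) |-> s t^-1, where each fibre is counted as often as it has elements;
    hence the division by the cardinal m of the fibre. *)
Lemma toeplitz_functional (f : dual Tp) :
  exists c : S -> S -> C, forall T, f T = toeplitz_sum c T.
Proof.
pose g (p : S * S) : G := (val p.1 * (val p.2)^-1)%g.
have [X hX] := choice (@toeplitz_indicator R G S).
pose m p : C := \sum_q (g q == g p)%:R.
have m0 p : m p != 0.
  by rewrite /m (bigD1 p) //= eqxx gt_eqF // ltr_wpDr // sumr_ge0.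
exists (fun s t => (m (s, t))^-1 * f (X (g (s, t)))) => T.
have {1}-> : T = \sum_p (entry T p.1 p.2 / m p) *: X (g p).
  apply: toeplitz_ext => s t; rewrite entry_sum.
  transitivity (\sum_p entry T s t / m (s, t) * (g p == g (s, t))%:R).
    by rewrite -mulr_sumr -/(m (s, t)) divfK.
  apply: eq_bigr => p _; rewrite hX -/(g (s, t)) [g (s, t) == _]eq_sym.
  case: eqP => [e|_]; last by rewrite !mulr0.
  by rewrite /m e; congr (_ / _ * _); apply/esym/toeplitz_entry; case: p e.
rewrite dual_sum toeplitz_sum_pair; apply: eq_bigr => -[s t] _ /=.
by rewrite -mulrA mulrC.
Qed.

(** Arveson's extension theorem in finite dimension. The functional
    Phi ((T_kl)) = sum f_kl (T_kl) is positive on the block Toeplitz matrices;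
    as these contain the identity, an order unit of all block matrices, Phi
    extends to a positive functional on all of them. The coefficients c of the
    extension form a positive matrix, the Choi matrix. *)
Lemma toeplitz_cp_extension n (f : 'M[dual Tp]_n) : mcone n f ->
  exists c : 'I_n * S -> 'I_n * S -> C, psd c /\
    forall k l, f k l =1 toeplitz_sum (fun s t => c (k, s) (l, t)).
Proof.
move=> [_ hf].
pose I : finType := ('I_n * S)%type.
pose block (T : 'M[Tp]_n) (a b : I) : C := entry (T a.1 b.1) a.2 b.2.
pose Phi (T : 'M[Tp]_n) : C := \sum_k \sum_l f k l (T k l).
have Phi_lin a (T U : 'M[Tp]_n) (W : 'M[Tp]_n) :
    (forall k l, W k l = a *: T k l + U k l) -> Phi W = a * Phi T + Phi U.
  move=> hW; rewrite /Phi mulr_sumr -big_split; apply: eq_bigr => k _.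
  rewrite mulr_sumr -big_split; apply: eq_bigr => l _ /=.
  by rewrite hW dual_linear.
have PhiD T U : Phi (T + U) = Phi T + Phi U.
  by rewrite (@Phi_lin 1 T U) ?mul1r // => k l; rewrite mxE scale1r.
have PhiZ a (T W : 'M[Tp]_n) : (forall k l, W k l = a *: T k l) -> Phi W = a * Phi T.
  move=> hW; rewrite (@Phi_lin a T 0) => [|k l]; last by rewrite hW mxE addr0.
  rewrite [Phi 0](_ : _ = 0) ?addr0 //; apply: (addIr (Phi 0)).
  by rewrite -PhiD addr0 add0r.
have PhiB T U : Phi (T - U) = Phi T - Phi U.
  by rewrite PhiD (@PhiZ (-1) U (- U)) ?mulN1r // => k l; rewrite mxE scaleN1r.
have Phi_pos T : mcone n T -> 0 <= Phi T.
  move=> /hf/matrix_mcone_psd h.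
  apply: (psd_pair_diag (M := fun k l i j => f i j (T k l))).
  by apply: eq_psd h => a b; rewrite !mxE.
pose curry2 (x : I * I -> C^o) (a b : I) : C := x (a, b).
(* The cone consists of the matrices with positive Hermitian part rather than
   of the positive ones, so that the identity is an order unit for the whole
   space of matrices. *)
pose P (x : I * I -> C^o) := forall w, 0 <= complex.Re (sform (curry2 x) w w).
pose K (x : I * I -> C^o) (r : R) := exists T : 'M[Tp]_n,
  (forall a b, x (a, b) = block T a b) /\ r = complex.Re (Phi T).
have ReZ (a : R) (z : C) : complex.Re (a%:C * z) = a * complex.Re z.
  by case: z => p q /=; rewrite mul0r subr0.
have ReD (z1 z2 : C) : complex.Re (z1 + z2) = complex.Re z1 + complex.Re z2.
  by case: z1 z2 => ? ? [].
have formD x y w : sform (curry2 (x + y)) w w =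
    sform (curry2 x) w w + sform (curry2 y) w w := sformD (curry2 x) (curry2 y) w.
have formZ a x w : sform (curry2 (a *: x)) w w = a * sform (curry2 x) w w :=
  sformZ a (curry2 x) w.
have P_add x y : P x -> P y -> P (x + y).
  by move=> hx hy w; rewrite formD ReD; apply: addr_ge0; [exact: hx|exact: hy].
have P_scale (a : R) x : 0 <= a -> P x -> P (a%:C *: x).
  by move=> a0 hx w; rewrite formZ ReZ; apply: mulr_ge0 => //; exact: hx.
pose u : I * I -> C^o := fun p => (p.1 == p.2)%:R.
have u_unit x : exists c : R, P (c%:C *: u + x).
  pose B : C := \sum_a \sum_b `|curry2 x a b|.
  have B0 : 0 <= B by rewrite sumr_ge0 // => a _; rewrite sumr_ge0.
  exists (complex.Re B) => w; rewrite formD formZ RRe_real ?ger0_real //.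
  have -> : sform (curry2 u) w w = \sum_a `|w a| ^+ 2.
    rewrite -[RHS]mul1r -sform_id /sform; apply: eq_bigr => a _.
    by apply: eq_bigr => b _; rewrite mul1r.
  have := sform_bound (curry2 x) w; rewrite -/B; set N := _ * _.
  set z := sform _ _ _ => zN.
  have N0 : 0 <= N := le_trans (normr_ge0 _) zN.
  have : `|complex.Re z|%:C <= (complex.Re N)%:C.
    by rewrite (RRe_real (ger0_real N0)) (le_trans (normc_ge_Re z)).
  by rewrite lecR ReD ler_norml => /andP[+ _]; rewrite -subr_ge0 opprK addrC.
have Ku : K u (complex.Re (Phi (\matrix_(k, l) ((k == l)%:R *: toeplitz1 R S)))).
  eexists; split; last by [].
  move=> [k s] [l t]; rewrite /block /u mxE entryZ entry_toeplitz1 xpair_eqE.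
  by rewrite -natrM mulnb.
have hK : positive_graph P K.
  split=> [x r y s [T [hT ->]] [U [hU ->]]|a x r [T [hT ->]]|x r [T [hT ->]] Px].
  - exists (T + U); rewrite PhiD ReD; split=> // a b.
    by rewrite /block mxE entryD -/(block T a b) -hT -/(block U a b) -hU.
  - exists (\matrix_(k, l) (a%:C *: T k l)); split=> [b d|].
      by rewrite /block mxE entryZ -/(block T b d) -hT.
    by rewrite -ReZ; congr complex.Re; apply/esym/PhiZ => k l; rewrite mxE.
  (* With U the adjoint of T: T + U is positive, so Phi (T + U) >= 0, while
       i (T - U) differs from a positive matrix by a positive one, so that
       Phi (T - U) is purely imaginary. Hence Re (Phi T) >= 0. *)
  - have [U [V [_ /Phi_pos V0 /Phi_pos W0 UE]]] := toeplitz_hermitize T.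
    have /Phi_pos : mcone n (T + U).
      apply/toeplitz_mcone_psd => w.
      have := Px w; set z := sform _ _ _ => z0.
      have -> : sform (fun a b : I => entry ((T + U) a.1 b.1) a.2 b.2) w w =
          z + Num.conj z.
        rewrite -sform_adj -sformD; apply: eq_bigr => a _; apply: eq_bigr => b _.
        by rewrite mxE entryD UE /curry2 (hT a b) (hT b a).
      by rewrite [Num.conj z](_ : _ = z^*%C) // addcJ mulr_ge0 // ler0c.
    rewrite PhiD => tu0; rewrite PhiD in W0.
    rewrite (@PhiZ 'i%C (T - U)) in W0; last by move=> k l; rewrite !mxE complexiE.
    rewrite PhiB in W0; move: tu0 V0 W0.
    move: (Phi T) (Phi U) (Phi V) => [t1 t2] [u1 u2] [v1 v2].
    rewrite !lecE /= => /andP[_ tu] /andP[/eqP v0 _] /andP[/eqP w0 _]; lra.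
have [c [c_pos c_ext]] := riesz_extension P_add P_scale u_unit hK Ku.
exists (fun a b => c (a, b)); split=> [w|k l T].
  pose x : I * I -> C^o := fun p => Num.conj (w p.1) * w p.2.
  have xE : \sum_p x p * c p = sform (fun a b => c (a, b)) w w.
    by rewrite /sform pair_bigA; apply: eq_bigr => -[a b] _; rewrite /x /= mulrAC.
  (* The rank one matrix x is positive, so every z x with Re z >= 0 lies in P.
     Taking z = 1, i, - i shows that the form of c is real and nonnegative. *)
  have rot (z : C) : 0 <= complex.Re z ->
      0 <= complex.Re (z * sform (fun a b => c (a, b)) w w).
    move=> z0; rewrite -xE mulr_sumr.
    have /c_pos : P (z *: x).
      move=> v; rewrite formZ; set y := \sum_a w a * v a.
      have -> : sform (curry2 x) v v = `|y| ^+ 2.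
        rewrite normCKC rmorph_sum mulr_suml; apply: eq_bigr => a _.
        rewrite mulr_sumr; apply: eq_bigr => b _; rewrite /curry2 /x rmorphM /=.
        by rewrite !mulrA (mulrC (Num.conj (v a))).
      rewrite -add_Re2_Im2 mulrC ReZ mulr_ge0 // addr_ge0 // sqr_ge0 //.
    by under eq_bigr do rewrite -mulrA.
  have := rot 1 ler01; have := rot 'i%C (lexx _).
  have : 0 <= complex.Re (- 'i%C : C) by rewrite /= oppr0.
  move=> /rot; rewrite mul1r; case: (sform _ w w) => p q /=; rewrite lecE /=.
  by move=> h1 h2 h3; apply/andP; split; [apply/eqP; lra|].
(* The extension agrees with Phi in real part; both are complex linear. *)
pose F i j := toeplitz_sum (fun s t => c ((i, s), (j, t))).
have Re_eq (T' : 'M[Tp]_n) : complex.Re (Phi T') =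
    complex.Re (\sum_i \sum_j F i j (T' i j)).
  rewrite (c_ext (fun p => block T' p.1 p.2) (complex.Re (Phi T'))); last by exists T'.
  congr complex.Re.
  transitivity (\sum_a \sum_b block T' a b * c (a, b)).
    by rewrite pair_bigA; apply: eq_bigr => -[].
  transitivity (\sum_i \sum_s \sum_j \sum_t block T' (i, s) (j, t) * c ((i, s), (j, t))).
    rewrite [RHS]pair_bigA; apply: eq_bigr => -[i s] _.
    by rewrite [RHS]pair_bigA; apply: eq_bigr => -[].
  apply: eq_bigr => i _; rewrite exchange_big; apply: eq_bigr => j _.
  by apply: eq_bigr => s _; apply: eq_bigr => t _; rewrite mulrC.
have single (Q : 'I_n -> 'I_n -> Tp -> C) (T' : Tp) : (forall i j, Q i j 0 = 0) ->
    \sum_i \sum_j Q i j (if (i == k) && (j == l) then T' else 0) = Q k l T'.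
  move=> Q0; rewrite (bigD1 k) //= (bigD1 l) //= !eqxx /= big1 ?addr0 => [|j /negPf->].
    rewrite big1 ?addr0 // => i /negPf-> /=.
    by apply: big1 => j _; rewrite Q0.
  by rewrite ?andbF Q0.
have f0 i j : f i j 0 = 0 := dual0 (f i j).
have F0 i j : F i j 0 = 0.
  by apply: big1 => s _; apply: big1 => t _; rewrite /entry mxE mulr0.
have Re_single T' : complex.Re (f k l T') = complex.Re (F k l T').
  rewrite -(single (fun i j => f i j) T' f0) -(single F T' F0).
  have := Re_eq (\matrix_(i, j) (if (i == k) && (j == l) then T' else 0)).
  by congr (complex.Re _ = complex.Re _); apply: eq_bigr => i _;
    apply: eq_bigr => j _; rewrite mxE.
have fi : f k l ('i%C *: T) = 'i%C * f k l T.
  by have := dual_linear (f k l) 'i%C T 0; rewrite !addr0 f0 addr0.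
have Fi : F k l ('i%C *: T) = 'i%C * F k l T.
  rewrite /F /toeplitz_sum mulr_sumr; apply: eq_bigr => s _.
  by rewrite mulr_sumr; apply: eq_bigr => t _; rewrite entryZ mulrCA.
have := Re_single ('i%C *: T); have := Re_single T; rewrite fi Fi -/(F k l).
case: (f k l T) (F k l T) => [p q] [p' q'] /=.
rewrite !mul0r !mul1r !sub0r => -> /oppr_inj->.
by [].
Qed.

(** The inverse preserves the cones: extend f to a positive functional on all
    block matrices and factor its coefficient matrix as V V^*; the columns of V
    are the coefficients of a sum of squares that represents f. *)
Lemma sos_to_dual_iso : complete_order_iso (sos_to_dual hA (S := S)).
Proof.
split; first exact: sos_to_dual_cp.
have inv_ex (f : dual Tp) : exists x : SOS, forall T, pairing T x = f T.
  have [c hc] := toeplitz_functional f; have [x hx] := sos_exists delta c.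
  by exists x => T; rewrite hc; exact: ((pairingP hA x c).1 hx T).
have [psi hpsi] := choice inv_ex.
exists psi.
have phidK : cancel (sos_to_dual hA (S := S)) psi.
  by move=> x; apply: (pairing_inj hA) => T; rewrite hpsi.
have psiK : cancel psi (sos_to_dual hA (S := S)).
  by move=> f; apply: dual_ext => T; exact: hpsi.
split=> //; split=> [a f g|n f hf].
  by apply: (can_inj phidK); rewrite psiK (sos_to_dual_linear hA) !psiK.
have [c [/psd_factor[V hV] hc]] := toeplitz_cp_extension hf.
apply/(sos_mconeP hA); exists #|{: S}|.
exists (fun q s => \matrix_(k, p) V (k, s) (p, enum_val q)) => k l.
rewrite mxE; apply/(pairingP hA) => T; rewrite hpsi hc.
apply: eq_bigr => s _; apply: eq_bigr => t _; congr (_ * _).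
rewrite hV.
pose h (x : 'I_#|{: S}| * 'I_n) : 'I_n * S := (x.2, enum_val x.1).
rewrite (reindex h) /=; first by apply: eq_bigr => -[q p] _; rewrite !mxE.
exists (fun a => (enum_rank a.2, a.1)) => -[i j] _; rewrite /h /=.
  by rewrite enum_valK.
by rewrite enum_rankK.
Qed.

End InverseDual.
Theorem corollary4p15 (R : realType) (G : groupType)
    (A : cstarAlgebraType R) (delta : G -> A) (hA : is_group_cstar delta)
    (S : {fset G}) (S0 : S != fset0) :
  exists (phi : toeplitz R S -> dual (sos delta S))
         (phid : sos delta S -> dual (toeplitz R S)),
    [/\ (forall (T : toeplitz R S) (s t : S),
           phi T (sos_delta delta s t) = entry T s t)
        /\ complete_order_iso phi,
        (forall (x : sos delta S) (T : toeplitz R S), phid x T = phi T x)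
        /\ complete_order_iso phid,
        forall s t : S,
          phi (toeplitz1 R S) (sos_delta delta s t) = (s == t)%:R
      & forall T : toeplitz R S,
          phid (sos_unit delta S0) T = #|{: S}|%:R^-1 * \tr (toeplitz_val T)].
Proof.
have phi_delta (T : toeplitz R S) (s t : S) :
    toeplitz_to_dual hA T (sos_delta delta s t) = entry T s t.
  exact: pairing_delta.
exists (toeplitz_to_dual hA (S := S)), (sos_to_dual hA (S := S)).
split=> [| |s t|T]; first by split=> //; exact: toeplitz_to_dual_iso.
- by split=> //; exact: sos_to_dual_iso.
- by rewrite phi_delta entry_toeplitz1.
have [s0 sS] := fset0Pn _ S0; pose s : S := [` sS]%fset.
have -> : sos_unit delta S0 = sos_delta delta s s.
  by apply: val_inj; rewrite /= mulgV.
transitivity (entry T s s); first exact: (phi_delta T s s).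
have -> : \tr (toeplitz_val T) = \sum_(t : S) entry T s s.
  rewrite /mxtrace (reindex (@enum_rank S)) /=; last exact/onW_bij/enum_rank_bij.
  by apply: eq_bigr => t _; apply: toeplitz_entry; rewrite /= !mulgV.
rewrite sumr_const -(mulr_natl (entry T s s)) mulKf // pnatr_eq0 -lt0n.
by apply/card_gt0P; exists s.
Qed.
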